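(* Let $L>0$. For each $j\ge1$, the mKdV-type vector field $\mathbf V_j=N_j\gamma_s+M_j(\mathrm i\gamma_s)+L_j(\mathrm i\gamma)$ represents a Hamiltonian vector field on $\mathcal Q_L$ with respect to the symplectic form $\Omega$; that is, there is a functional $\mathscr H_j$ on $\mathcal Q_L$ such that $d(\mathscr H_j)_{[\gamma]}(\mathcal V)=\Omega_{[\gamma]}(\mathcal V,[\mathbf V_j])$ for all $[\gamma]\in\mathcal Q_L$ and $\mathcal V\in T_{[\gamma]}\mathcal Q_L$.
   Context: $S^3\subset\mathbb C^2$ is the set of unit vectors for the standard Hermitian inner product $\langle\cdot,\cdot\rangle$ (linear in the first slot). A regular smooth curve $\gamma:\mathbb R\to S^3$ with parameter $x$ is Legendrian if $\langle\gamma_x,\gamma\rangle=0$. Its curvature is $k=\mathrm{Im}\langle\gamma_{xx},\gamma_x\rangle/\langle\gamma_x,\gamma_x\rangle^{3/2}$, and $\partial_s=\langle\gamma_x,\gamma_x\rangle^{-1/2}\partial_x$ is the arclength derivative. $\mathcal P_L$ is the (infinite-dimensional) manifold of regular Legendrian curves that are $L$-periodic in $x$. Its tangent vectors at $\gamma$ are the vector fields along $\gamma$ of the form $p\gamma_x+q(\mathrm i\gamma_x)+r(\mathrm i\gamma)$ with $p,q,r$ real-valued smooth $L$-periodic functions and $r_x=2q\langle\gamma_x,\gamma_x\rangle$. $\mathcal Q_L$ is the quotient of $\mathcal P_L$ by the group generated by the flows of $\mathrm i\gamma$ (constant rotations $\gamma\mapsto e^{\mathrm i\theta}\gamma$) and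 of $f(x)\gamma_x$ with $f$ $L$-periodic (period-preserving reparametrizations). Tangent vectors of $\mathcal Q_L$ at $[\gamma]$ are equivalence classes of elements of $T_\gamma\mathcal P_L$, two being equivalent if they differ by a constant real multiple of $\mathrm i\gamma$ plus some $f(x)\gamma_x$ with $f$ $L$-periodic. The symplectic form on $\mathcal Q_L$ is $\Omega_{[\gamma]}(\mathcal V,\mathcal W)=-\int_0^L\det_{\mathbb R}(\gamma,\gamma_x,\mathbf V,\mathbf W)\,dx$ for any representatives $\mathbf V,\mathbf W$, where $\det_{\mathbb R}$ is the determinant of the $4\times4$ real matrix obtained by identifying each $(z_1,z_2)^T\in\mathbb C^2$ with $(\mathrm{Re}\,z_1,\mathrm{Im}\,z_1,\mathrm{Re}\,z_2,\mathrm{Im}\,z_2)^T$. mKdV hierarchy: on differential polynomials in $u=u_0,u_1,u_2,\dots$ let $\delta P=\sum_{j\ge 0} u_{j+1}\,\partial P/\partial u_j$ (total $s$-derivative) and $\mathsf E P=\sum_{j\ge 0}(-\delta)^j(\partial P/\partial u_j)$ (Euler operator). There is a sequence of differential polynomials $\rho_j$ with $\rho_1=\frac12u^2$ and $\delta\,\mathsf E\rho_{j+1}=(\delta^3+\delta u\delta^{-1}u\delta)\mathsf E\rho_j$. Put $M_j=\delta\mathsf E\rho_j$, $L_j=2\mathsf E\rho_j$, and let $N_j$ be the differential polynomial with $\delta N_j=uM_j$; inverses $\delta^{-1}$ are taken with zero constant term. Equivalently: $M_1=u_1$, $N_1=\frac12u^2$, $L_1=2u$, $M_{j+1}=\delta^2M_j+\delta(uN_j)$,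 $L_{j+1}=2(\delta M_j+uN_j)$. In $\mathbf V_j$ one substitutes for $u_i$ the $i$-th arclength derivative of the curvature $k$ of $\gamma$. *)

(* Defs.v *)
From Stdlib Require Import Reals Arith Relations.
From Coquelicot Require Import Coquelicot.
Open Scope R_scope.

Definition C2 : Type := (C * C)%type.
Definition curve : Type := R -> C2.

Definition c2_add (z w : C2) : C2 := ((fst z + fst w)%C, (snd z + snd w)%C).
Definition c2_scal (c : C) (z : C2) : C2 := ((c * fst z)%C, (c * snd z)%C).

Declare Scope c2_scope.
Delimit Scope c2_scope with C2.
Notation "z + w" := (c2_add z w) : c2_scope.
Notation "c *: z" := (c2_scal c z) (at level 40, left associativity) : c2_scope.
Notation "r *r: z" := (c2_scal (RtoC r) z)
  (at level 40, left associativity) : c2_scope.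

Definition herm (z w : C2) : C :=
  (fst z * Cconj (fst w) + snd z * Cconj (snd w))%C.

(* The identification C^2 = R^4; only the indices i < 4 are meaningful
   (larger ones repeat the last coordinate). *)
Definition coord (z : C2) (i : nat) : R :=
  match i with
  | 0%nat => Re (fst z)
  | 1%nat => Im (fst z)
  | 2%nat => Re (snd z)
  | _ => Im (snd z)
  end.

(* Determinant of (A i j) for i, j < n, by Laplace expansion along row 0. *)
Fixpoint det (n : nat) (A : nat -> nat -> R) : R :=
  match n with
  | 0%nat => 1
  | S m =>
      sum_f_R0
        (fun j => (-1) ^ j * A 0%nat j *
           det m (fun i k => A (S i) (if k <? j then k else S k))) m
  end.

Definition detR (a b c d : C2) : R :=
  det 4 (fun i j =>
    coord (match j with 0%nat => a | 1%nat => b | 2%nat => c | _ => d end) i).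

Definition smooth (f : R -> R) : Prop := forall n x, ex_derive_n f n x.
Definition smooth2 (f : R -> R -> R) : Prop :=
  forall n t x, ex_diff_n f n t x.
Definition periodic (L : R) (f : R -> R) : Prop := forall x, f (x + L) = f x.

Definition smooth_curve (g : curve) : Prop :=
  forall i, smooth (fun x => coord (g x) i).

Definition D (g : curve) : curve := fun x =>
  ((Derive (fun y => coord (g y) 0) x, Derive (fun y => coord (g y) 1) x),
   (Derive (fun y => coord (g y) 2) x, Derive (fun y => coord (g y) 3) x)).

Definition PL (L : R) (g : curve) : Prop :=
  smooth_curve g /\
  (forall x, herm (g x) (g x) = RtoC 1) /\
  (forall x, herm (D g x) (D g x) <> RtoC 0) /\
  (forall x, herm (D g x) (g x) = RtoC 0) /\
  (forall x, g (x + L) = g x).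

(* [herm z z] is real, so [Re] loses nothing. *)
Definition normsq (g : curve) (x : R) : R := Re (herm (D g x) (D g x)).
Definition speed (g : curve) (x : R) : R := sqrt (normsq g x).

Definition curvature (g : curve) (x : R) : R :=
  Im (herm (D (D g) x) (D g x)) / speed g x ^ 3.

Definition Ds (g : curve) (f : R -> R) : R -> R :=
  fun x => / speed g x * Derive f x.

Definition unit_tangent (g : curve) : curve :=
  fun x => (/ speed g x *r: D g x)%C2.

Definition TPL (L : R) (g : curve) (V : curve) : Prop :=
  exists p q r : R -> R,
    (smooth p /\ smooth q /\ smooth r) /\
    (periodic L p /\ periodic L q /\ periodic L r) /\
    (forall x, Derive r x = 2 * q x * normsq g x) /\
    (forall x, V x =
       (p x *r: D g x + q x *r: (Ci *: D g x) + r x *r: (Ci *: g x))%C2).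

(* Two elements of [TPL L g] represent the same tangent vector of the
   quotient. *)
Definition tangent_equiv (L : R) (g : curve) (V W : curve) : Prop :=
  exists (c : R) (f : R -> R),
    smooth f /\ periodic L f /\
    (forall x, V x = (W x + c *r: (Ci *: g x) + f x *r: D g x)%C2).

Definition smooth_path (L : R) (G : R -> curve) : Prop :=
  (forall i, smooth2 (fun t x => coord (G t x) i)) /\ (forall t, PL L (G t)).

Definition velocity (G : R -> curve) (t : R) : curve :=
  fun x => D (fun u => G u x) t.

Definition integral_curve (L : R) (X : curve -> curve) (G : R -> curve) : Prop :=
  smooth_path L G /\ (forall t x, velocity G t x = X (G t) x).

(* The integral curves through g are exp(i t) g in the first case, and g o phi_t
   in the second, where phi is the flow on R of f(x) d/dx. *)
Definition generator (L : R) (X : curve -> curve) : Prop :=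
  X = (fun g x => (Ci *: g x)%C2) \/
  exists f, smooth f /\ periodic L f /\ X = (fun g x => (f x *r: D g x)%C2).

Definition flow_step (L : R) (g h : curve) : Prop :=
  exists X G t,
    generator L X /\ integral_curve L X G /\ G 0 = g /\ G t = h.

Definition same_class (L : R) : relation curve :=
  clos_refl_sym_trans curve (flow_step L).

(* A functional on the quotient: only the values of H on [PL L] matter, and
   they depend only on the class of the curve. *)
Definition functional_on_QL (L : R) (H : curve -> R) : Prop :=
  forall g h, PL L g -> PL L h -> same_class L g h -> H g = H h.

(* dH_g(V) = d.  Every element V of [TPL L g] is the velocity of such a path. *)
Definition has_differential
    (L : R) (H : curve -> R) (g V : curve) (d : R) : Prop :=
  forall G, smooth_path L G -> G 0 = g -> (forall x, velocity G 0 x = V x) ->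
    is_derive (fun t => H (G t)) 0 d.

Definition Omega (L : R) (g V W : curve) : R :=
  - RInt (fun x => detR (g x) (D g x) (V x) (W x)) 0 L.

(* Omega and dH are evaluated on arbitrary representatives of classes: V and V'
   represent the same tangent vector of the quotient, W that of X g. *)
Definition represents_hamiltonian_field (L : R) (X : curve -> curve) : Prop :=
  (forall g, PL L g -> TPL L g (X g)) /\
  exists H : curve -> R,
    functional_on_QL L H /\
    forall g V V' W,
      PL L g -> TPL L g V -> TPL L g V' -> TPL L g W ->
      tangent_equiv L g V' V -> tangent_equiv L g W (X g) ->
      has_differential L H g V (Omega L g V' W).

(* Polynomial expressions with real coefficients in u_0, u_1, ...; they denote
   elements of R[u_0, u_1, ...], and since R is infinite two of them denote the
   same polynomial exactly when they take the same values: see [dp_eq]. *)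
Inductive dpoly : Type :=
  | dC (c : R)
  | dU (i : nat)
  | dAdd (P Q : dpoly)
  | dMul (P Q : dpoly).

Declare Scope dpoly_scope.
Delimit Scope dpoly_scope with dp.
Bind Scope dpoly_scope with dpoly.
Notation "P + Q" := (dAdd P Q) : dpoly_scope.
Notation "P * Q" := (dMul P Q) : dpoly_scope.

Fixpoint dp_eval (P : dpoly) (a : nat -> R) : R :=
  match P with
  | dC c => c
  | dU i => a i
  | dAdd P Q => dp_eval P a + dp_eval Q a
  | dMul P Q => dp_eval P a * dp_eval Q a
  end.

Definition dp_eq (P Q : dpoly) : Prop := forall a, dp_eval P a = dp_eval Q a.
Infix "==" := dp_eq (at level 70) : dpoly_scope.

Definition constant_term (P : dpoly) : R := dp_eval P (fun _ => 0).

Fixpoint dp_partial (j : nat) (P : dpoly) : dpoly :=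
  match P with
  | dC _ => dC 0
  | dU i => if i =? j then dC 1 else dC 0
  | dAdd P Q => dAdd (dp_partial j P) (dp_partial j Q)
  | dMul P Q => dAdd (dMul (dp_partial j P) Q) (dMul P (dp_partial j Q))
  end.

(* Only the u_j with j < dp_bound P occur in P, so the sums over j >= 0 below
   may be truncated at dp_bound P. *)
Fixpoint dp_bound (P : dpoly) : nat :=
  match P with
  | dC _ => 0
  | dU i => S i
  | dAdd P Q | dMul P Q => Nat.max (dp_bound P) (dp_bound Q)
  end.

Fixpoint dp_sum (n : nat) (F : nat -> dpoly) : dpoly :=
  match n with
  | 0%nat => dC 0
  | S m => dAdd (dp_sum m F) (F m)
  end.

Definition delta (P : dpoly) : dpoly :=
  dp_sum (dp_bound P) (fun j => (dU (S j) * dp_partial j P)%dp).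

Definition euler (P : dpoly) : dpoly :=
  dp_sum (dp_bound P)
    (fun j => Nat.iter j (fun Q => (dC (-1) * delta Q)%dp) (dp_partial j P)).

(* The sequences are indexed from 1 (the terms of index 0 are unconstrained).
   [N j] is delta^{-1} (u M_j) = delta^{-1} u delta (euler (rho j)), which is
   what enters the recursion; the conditions on constant terms make
   M, N, Lam unique. *)
Definition mKdV_hierarchy (rho M N Lam : nat -> dpoly) : Prop :=
  (rho 1%nat == dC (1 / 2) * (dU 0 * dU 0))%dp /\
  forall j, (1 <= j)%nat ->
    (M j == delta (euler (rho j)))%dp /\
    (Lam j == dC 2 * euler (rho j))%dp /\
    constant_term (Lam j) = 0 /\
    (delta (N j) == dU 0 * M j)%dp /\
    constant_term (N j) = 0 /\
    (delta (euler (rho (S j))) ==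
       delta (delta (delta (euler (rho j)))) + delta (dU 0 * N j))%dp.

Definition jet (g : curve) (x : R) : nat -> R :=
  fun i => Nat.iter i (Ds g) (curvature g) x.

Definition mKdV_field (N M Lam : dpoly) (g : curve) : curve := fun x =>
  (dp_eval N (jet g x) *r: unit_tangent g x
   + dp_eval M (jet g x) *r: (Ci *: unit_tangent g x)
   + dp_eval Lam (jet g x) *r: (Ci *: g x))%C2.

(* Main.v *)
Require Import Defs.
From Stdlib Require Import Reals Lra Lia Arith FunctionalExtensionality Relations.
From Coquelicot Require Import Coquelicot.
(* Imported again so that [D] denotes the derivative of a curve. *)
Import Defs.
Open Scope R_scope.

(** Let v be the speed of the curve g and V = p g_x + q (i g_x) + r (i g) a tangent
    vector, so that r_x = 2 q v^2. Because det(g, g_x, i g_x, i g) = v^2,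
    M_j = delta E(rho_j) and L_j = 2 E(rho_j), one integration by parts gives
    Omega(V, V_j) = -4 int q v^2 E(rho_j) dx ([Omega_mKdV_field]). A Hamiltonian for
    V_j is therefore a functional whose differential is this pairing of q v^2 with
    -4 E(rho_j).

    Such functionals are built from the integrals I(P) = int P(k, k_s, ...) ds of
    differential polynomials. Under the variation V, and up to the transport by the
    tangential part p, the curvature changes by b_ss + (k^2 + 4) b with b = q v
    ([curvature_variation]) and arclength changes at the rate -k b
    ([speed_variation]). Integrating by parts,
    dI(P)(V) = int q v^2 (delta^2 E(P) + 4 E(P) + u N_P) dx,
    where N_P is an explicit differential polynomial with delta N_P = u delta E(P)
    ([first_variation], [delta_noether]). The nonlocal operator
    delta^2 + u delta^{-1} u delta of the mKdV recursion thus appears as the part of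
    the first variation that does not come from the curvature of the sphere.

    For P = rho_j, a differential polynomial with zero total derivative being constant
    ([delta_kernel]), N_P is N_j minus the constant term c_j of rho_j, and the
    recursion gives dI(rho_j)(V) = int q v^2 (E(rho_(j+1)) + 4 E(rho_j) - c_j k) dx. The
    length I(1) has differential -int q v^2 k dx, and E(rho_1) = u. Hence
    H_1 = 4 I(1) and H_(j+1) = -4 (I(rho_j) - c_j I(1)) - 4 H_j have the required
    differentials ([hamiltonian_variation]). The velocities of the flows defining the
    quotient have q = 0, so the same formula shows that the H_j are constant along
    these flows and descend to the quotient ([hamiltonian_on_QL]). *)

(** * Smooth functions of one and two variables *)

Definition dt (F : R -> R -> R) : R -> R -> R := fun t x => Derive (fun z => F z x) t.
Definition dx (F : R -> R -> R) : R -> R -> R := fun t x => Derive (fun z => F t z) x.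

(** Closure properties are proved by induction on the order of differentiability,
    so that the two first partial derivatives of a product or a square root, which
    involve the function itself again, fall under the induction hypothesis. *)
Definition smoothN (n : nat) (F : R -> R -> R) : Prop := forall t x, ex_diff_n F n t x.

Lemma smoothN_le n m F : (m <= n)%nat -> smoothN n F -> smoothN m F.
Proof. intros Hmn HF t x. now apply (ex_diff_n_m n m Hmn). Qed.

Lemma smoothN_S n F :
  smoothN (S n) F <->
  (forall t x, continuity_2d_pt F t x) /\
  (forall t x, ex_derive (fun z => F z x) t) /\
  (forall t x, ex_derive (fun z => F t z) x) /\
  smoothN n (dt F) /\ smoothN n (dx F).
Proof.
  split.
  - intros H; repeat apply conj; intros t x; destruct (H t x) as (H1 & H2 & H3 & H4 & H5); auto.
  - intros (H1 & H2 & H3 & H4 & H5) t x. simpl. repeat apply conj; auto.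
Qed.

Lemma smooth2_continuity F t x : smooth2 F -> continuity_2d_pt F t x.
Proof. intros H; exact (proj1 (H 0%nat t x)). Qed.

Lemma smooth2_ex_dt F t x : smooth2 F -> ex_derive (fun z => F z x) t.
Proof. intros H. apply (H 1%nat t x). Qed.

Lemma smooth2_ex_dx F t x : smooth2 F -> ex_derive (fun z => F t z) x.
Proof. intros H. apply (H 1%nat t x). Qed.

Lemma smooth2_dt F : smooth2 F -> smooth2 (dt F).
Proof. intros H n t x. apply (H (S n) t x). Qed.

Lemma smooth2_dx F : smooth2 F -> smooth2 (dx F).
Proof. intros H n t x. apply (H (S n) t x). Qed.

Lemma dt_dx F : smooth2 F -> dt (dx F) = dx (dt F).
Proof.
  intros H. apply functional_extensionality; intros t; apply functional_extensionality; intros x.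
  unfold dt, dx. apply Schwarz.
  - exists (mkposreal 1 Rlt_0_1). intros u v _ _. repeat split.
    + now apply smooth2_ex_dt.
    + now apply smooth2_ex_dx.
    + apply (smooth2_ex_dt (dx F)). now apply smooth2_dx.
    + apply (smooth2_ex_dx (dt F)). now apply smooth2_dt.
  - apply (smooth2_continuity (dt (dx F))). now apply smooth2_dt, smooth2_dx.
  - apply (smooth2_continuity (dx (dt F))). now apply smooth2_dx, smooth2_dt.
Qed.

Lemma smoothN_const n c : smoothN n (fun _ _ => c).
Proof.
  revert c; induction n as [|n IH]; intros c.
  - intros t x. split; auto. apply continuity_2d_pt_const.
  - apply smoothN_S. repeat apply conj.
    + intros; apply continuity_2d_pt_const.
    + intros; apply ex_derive_const.
    + intros; apply ex_derive_const.
    + replace (dt (fun _ _ => c)) with (fun _ _ : R => 0); [apply IH|].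
      do 2 (apply functional_extensionality; intro). symmetry; unfold dt, dx; apply Derive_const.
    + replace (dx (fun _ _ => c)) with (fun _ _ : R => 0); [apply IH|].
      do 2 (apply functional_extensionality; intro). symmetry; unfold dt, dx; apply Derive_const.
Qed.

Lemma smoothN_plus n F G :
  smoothN n F -> smoothN n G -> smoothN n (fun t x => F t x + G t x).
Proof.
  revert F G; induction n as [|n IH]; intros F G HF HG.
  - intros t x. split; auto. apply continuity_2d_pt_plus; [apply HF | apply HG].
  - apply smoothN_S in HF as (F1 & F2 & F3 & F4 & F5).
    apply smoothN_S in HG as (G1 & G2 & G3 & G4 & G5).
    apply smoothN_S. repeat apply conj.
    + intros; now apply continuity_2d_pt_plus.
    + intros; now apply (ex_derive_plus (V := R_NormedModule) (fun z => F z x) (fun z => G z x)).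
    + intros; now apply (ex_derive_plus (V := R_NormedModule) (fun z => F t z) (fun z => G t z)).
    + replace (dt (fun t x => F t x + G t x)) with (fun t x => dt F t x + dt G t x); [now apply IH|].
      apply functional_extensionality; intros t; apply functional_extensionality; intros x.
      symmetry. now apply (Derive_plus (fun z => F z x) (fun z => G z x) t).
    + replace (dx (fun t x => F t x + G t x)) with (fun t x => dx F t x + dx G t x); [now apply IH|].
      apply functional_extensionality; intros t; apply functional_extensionality; intros x.
      symmetry. now apply (Derive_plus (fun z => F t z) (fun z => G t z) x).
Qed.

Lemma smoothN_mult n F G :
  smoothN n F -> smoothN n G -> smoothN n (fun t x => F t x * G t x).
Proof.
  revert F G; induction n as [|n IH]; intros F G HF HG.
  - intros t x. split; auto. apply continuity_2d_pt_mult; [apply HF | apply HG].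
  - pose proof (smoothN_le (S n) n _ (Nat.le_succ_diag_r n) HF) as F0.
    pose proof (smoothN_le (S n) n _ (Nat.le_succ_diag_r n) HG) as G0.
    apply smoothN_S in HF as (F1 & F2 & F3 & F4 & F5).
    apply smoothN_S in HG as (G1 & G2 & G3 & G4 & G5).
    apply smoothN_S. repeat apply conj.
    + intros; now apply continuity_2d_pt_mult.
    + intros; now apply (ex_derive_mult (fun z => F z x) (fun z => G z x)).
    + intros; now apply (ex_derive_mult (fun z => F t z) (fun z => G t z)).
    + replace (dt (fun t x => F t x * G t x)) with (fun t x => dt F t x * G t x + F t x * dt G t x).
      { apply smoothN_plus; now apply IH. }
      apply functional_extensionality; intros t; apply functional_extensionality; intros x.
      symmetry. now apply (Derive_mult (fun z => F z x) (fun z => G z x) t).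
    + replace (dx (fun t x => F t x * G t x)) with (fun t x => dx F t x * G t x + F t x * dx G t x).
      { apply smoothN_plus; now apply IH. }
      apply functional_extensionality; intros t; apply functional_extensionality; intros x.
      symmetry. now apply (Derive_mult (fun z => F t z) (fun z => G t z) x).
Qed.

Lemma smooth2_const c : smooth2 (fun _ _ => c).
Proof. intros n; apply smoothN_const. Qed.

Lemma smooth2_plus F G : smooth2 F -> smooth2 G -> smooth2 (fun t x => F t x + G t x).
Proof. intros HF HG n; apply smoothN_plus; [exact (HF n) | exact (HG n)]. Qed.

Lemma smooth2_mult F G : smooth2 F -> smooth2 G -> smooth2 (fun t x => F t x * G t x).
Proof. intros HF HG n; apply smoothN_mult; [exact (HF n) | exact (HG n)]. Qed.

Lemma smooth2_opp F : smooth2 F -> smooth2 (fun t x => - F t x).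
Proof.
  intros HF. replace (fun t x => - F t x) with (fun t x => (-1) * F t x).
  - now apply smooth2_mult; [apply smooth2_const|].
  - do 2 (apply functional_extensionality; intro); ring.
Qed.

Lemma smooth2_minus F G : smooth2 F -> smooth2 G -> smooth2 (fun t x => F t x - G t x).
Proof. intros; apply smooth2_plus; auto. now apply smooth2_opp. Qed.

Lemma smooth2_pow F k : smooth2 F -> smooth2 (fun t x => F t x ^ k).
Proof.
  intros HF; induction k as [|k IH]; simpl.
  - apply smooth2_const.
  - now apply smooth2_mult.
Qed.

Lemma is_derive_inv_sqrt (f : R -> R) x : 0 < f x -> ex_derive f x ->
  is_derive (fun z => / sqrt (f z)) x (Derive f x * (-(1/2) * (/ sqrt (f x)) ^ 3)).
Proof.
  intros Hp Hd. pose proof (sqrt_lt_R0 _ Hp). auto_derive.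
  - repeat split; auto. lra.
  - replace (/ sqrt (f x) ^ 3) with (/ (sqrt (f x) * (sqrt (f x) * sqrt (f x)))) by (f_equal; ring).
    change (Derive (fun x0 => f x0) x) with (Derive f x). field. lra.
Qed.

Lemma smoothN_inv_sqrt n F : (forall t x, 0 < F t x) -> smooth2 F ->
  smoothN n (fun t x => / sqrt (F t x)).
Proof.
  intros Hp HF; induction n as [|n IH].
  - intros t x; split; auto.
    apply (continuity_1d_2d_pt_comp (fun y => / sqrt y) F).
    + apply continuity_pt_filterlim.
      apply (ex_derive_continuous (V := R_NormedModule) (fun y => / sqrt y) (F t x)).
      auto_derive. pose proof (Hp t x) as H. split; [exact H | split; [|exact I]].
      now apply Rgt_not_eq, sqrt_lt_R0.
    + now apply smooth2_continuity.
  - assert (W3 : smoothN n (fun t x => - (1/2) * (/ sqrt (F t x)) ^ 3)).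
    { apply smoothN_mult; [apply smoothN_const|]. simpl.
      repeat (apply smoothN_mult; auto). apply smoothN_const. }
    assert (E1 : forall t x, is_derive (fun z => / sqrt (F z x)) t
       (dt F t x * (-(1/2) * (/ sqrt (F t x)) ^ 3))).
    { intros. apply (is_derive_inv_sqrt (fun z => F z x)); auto. now apply smooth2_ex_dt. }
    assert (E2 : forall t x, is_derive (fun z => / sqrt (F t z)) x
       (dx F t x * (-(1/2) * (/ sqrt (F t x)) ^ 3))).
    { intros. apply (is_derive_inv_sqrt (fun z => F t z)); auto. now apply smooth2_ex_dx. }
    apply smoothN_S; repeat apply conj.
    + intros t x. destruct n; apply IH.
    + intros t x; eexists; apply E1.
    + intros t x; eexists; apply E2.
    + replace (dt (fun t x => / sqrt (F t x)))
        with (fun t x => dt F t x * (-(1/2) * (/ sqrt (F t x)) ^ 3)).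
      { apply smoothN_mult; auto. exact (smooth2_dt F HF n). }
      do 2 (apply functional_extensionality; intro). apply eq_sym, is_derive_unique, E1.
    + replace (dx (fun t x => / sqrt (F t x)))
        with (fun t x => dx F t x * (-(1/2) * (/ sqrt (F t x)) ^ 3)).
      { apply smoothN_mult; auto. exact (smooth2_dx F HF n). }
      do 2 (apply functional_extensionality; intro). apply eq_sym, is_derive_unique, E2.
Qed.

Lemma smooth2_inv_sqrt F : (forall t x, 0 < F t x) -> smooth2 F ->
  smooth2 (fun t x => / sqrt (F t x)).
Proof. intros Hp HF n. now apply smoothN_inv_sqrt. Qed.

Lemma smooth_ex_derive f x : smooth f -> ex_derive f x.
Proof. intros H. exact (H 1%nat x). Qed.

Lemma Derive_n_Derive n f x : Derive_n (Derive f) n x = Derive_n f (S n) x.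
Proof.
  replace (S n) with (n + 1)%nat by lia. rewrite <- Derive_n_comp. reflexivity.
Qed.

Lemma smooth_Derive f : smooth f -> smooth (Derive f).
Proof.
  intros H [|n] x; simpl; auto.
  apply (ex_derive_ext (Derive_n f (S n))).
  - intros t; symmetry; unfold dt, dx; apply Derive_n_Derive.
  - exact (H (S (S n)) x).
Qed.

(** Constancy in time turns one-variable smoothness into two-variable smoothness,
    and [smooth_slice] goes back: facts about a single curve are read off from
    facts about families. *)
Lemma smooth_lift f : smooth f -> smooth2 (fun _ x => f x).
Proof.
  intros H n; revert f H; induction n as [|n IH]; intros f H.
  - intros t x; split; auto.
    apply (continuity_1d_2d_pt_comp f (fun _ x => x)).
    + apply continuity_pt_filterlim. apply (ex_derive_continuous (V := R_NormedModule)). now apply smooth_ex_derive.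
    + apply continuity_2d_pt_id2.
  - intros t x. change (ex_diff_n (fun _ x => f x) (S n) t x).
    revert t x. apply smoothN_S. repeat apply conj.
    + intros t x. destruct n; apply (IH f H).
    + intros; apply ex_derive_const.
    + intros; now apply smooth_ex_derive.
    + replace (dt (fun _ x => f x)) with (fun _ _ : R => 0); [apply smoothN_const|].
      do 2 (apply functional_extensionality; intro). symmetry; unfold dt, dx; apply Derive_const.
    + exact (IH (Derive f) (smooth_Derive f H)).
Qed.

Lemma smooth_slice F t : smooth2 F -> smooth (F t).
Proof.
  intros H n x.
  assert (E : forall n, exists G, smooth2 G /\ Derive_n (F t) n = G t).
  { clear n x. induction n as [|n (G & HG & E)].
    - exists F; auto.
    - exists (dx G). split; [now apply smooth2_dx|].
      simpl. rewrite E. reflexivity. }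
  destruct n as [|n]; simpl; auto.
  destruct (E n) as (G & HG & ->). now apply (smooth2_ex_dx G).
Qed.

Lemma smooth_const c : smooth (fun _ => c).
Proof. apply (smooth_slice (fun _ _ => c) 0), smooth2_const. Qed.

Lemma smooth_plus f g : smooth f -> smooth g -> smooth (fun x => f x + g x).
Proof.
  intros; apply (smooth_slice (fun _ x => f x + g x) 0). apply smooth2_plus; now apply smooth_lift.
Qed.

Lemma smooth_mult f g : smooth f -> smooth g -> smooth (fun x => f x * g x).
Proof.
  intros; apply (smooth_slice (fun _ x => f x * g x) 0). apply smooth2_mult; now apply smooth_lift.
Qed.

Lemma smooth_continuous f x : smooth f -> continuous f x.
Proof. intros H. apply (ex_derive_continuous (V := R_NormedModule)). now apply smooth_ex_derive. Qed.

Lemma smooth_ex_RInt f a b : smooth f -> ex_RInt f a b.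
Proof. intros H. apply (ex_RInt_continuous (V := R_CompleteNormedModule)). intros; now apply smooth_continuous. Qed.

Lemma periodic_Derive L f : periodic L f -> periodic L (Derive f).
Proof.
  intros H x. unfold Derive.
  f_equal. apply Lim_ext. intros h.
  replace (x + L + h) with (x + h + L) by ring. now rewrite !H.
Qed.

Lemma RInt_Derive_periodic L f : smooth f -> periodic L f -> RInt (Derive f) 0 L = 0.
Proof.
  intros Hf Hp. rewrite RInt_Derive.
  - apply Rminus_diag_eq. now rewrite <- (Hp 0), Rplus_0_l.
  - intros; now apply smooth_ex_derive.
  - intros. apply smooth_continuous. now apply smooth_Derive.
Qed.

(** All boundary terms in the variational calculus vanish by periodicity, through
    this lemma and [RInt_Derive_periodic]. *)
Lemma RInt_by_parts_periodic L f g : smooth f -> smooth g -> periodic L f -> periodic L g ->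
  RInt (fun x => f x * Derive g x) 0 L = RInt (fun x => - Derive f x * g x) 0 L.
Proof.
  intros Hf Hg Pf Pg.
  pose proof (smooth_Derive _ Hf) as Hf'. pose proof (smooth_Derive _ Hg) as Hg'.
  assert (E : RInt (fun x => f x * Derive g x) 0 L - RInt (fun x => - Derive f x * g x) 0 L
    = RInt (Derive (fun x => f x * g x)) 0 L).
  { rewrite <- (RInt_minus (V := R_CompleteNormedModule)).
    - apply RInt_ext. intros x _. rewrite Derive_mult by now apply smooth_ex_derive.
      
      change (f x * Derive g x - - Derive f x * g x = Derive f x * g x + f x * Derive g x). ring.
    - apply (smooth_ex_RInt (fun x => f x * Derive g x)). now apply smooth_mult.
    - apply (smooth_ex_RInt (fun x => - Derive f x * g x)).
      apply smooth_mult; auto.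
      apply (smooth_slice (fun _ x => - Derive f x) 0). apply smooth2_opp. now apply smooth_lift. }
  rewrite RInt_Derive_periodic in E; [lra | now apply smooth_mult |].
  intros x. now rewrite Pf, Pg.
Qed.

(** * Differential polynomials and the kernel of the total derivative *)

Fixpoint rsum (n : nat) (f : nat -> R) : R :=
  match n with
  | 0%nat => 0
  | S m => rsum m f + f m
  end.

Lemma rsum_S n f : rsum (S n) f = rsum n f + f n.
Proof. reflexivity. Qed.

Lemma dp_eval_sum n F a : dp_eval (dp_sum n F) a = rsum n (fun j => dp_eval (F j) a).
Proof. induction n as [|n IH]; simpl; [reflexivity|]. now rewrite IH. Qed.

Lemma rsum_ext n f g : (forall j, (j < n)%nat -> f j = g j) -> rsum n f = rsum n g.
Proof.
  intros H; induction n as [|n IH]; [reflexivity|].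
  rewrite !rsum_S, IH, H; auto.
Qed.

Lemma rsum_plus n f g : rsum n (fun j => f j + g j) = rsum n f + rsum n g.
Proof. induction n as [|n IH]; [unfold rsum; simpl; ring|]. rewrite !rsum_S, IH. ring. Qed.

Lemma rsum_scal n c f : rsum n (fun j => c * f j) = c * rsum n f.
Proof. induction n as [|n IH]; [unfold rsum; simpl; ring|]. rewrite !rsum_S, IH. ring. Qed.

Lemma rsum_0 n f : (forall j, (j < n)%nat -> f j = 0) -> rsum n f = 0.
Proof.
  intros H; induction n as [|n IH]; [reflexivity|]. rewrite rsum_S, IH, H; auto. ring.
Qed.

Lemma rsum_extend n m f : (n <= m)%nat -> (forall j, (n <= j)%nat -> f j = 0) ->
  rsum m f = rsum n f.
Proof.
  intros Hnm H; induction Hnm as [|m Hm IH]; [reflexivity|].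
  rewrite rsum_S, IH, H; auto. ring.
Qed.

Lemma rsum_delta n i f : (i < n)%nat -> (forall j, j <> i -> f j = 0) -> rsum n f = f i.
Proof.
  intros Hi H. rewrite (rsum_extend (S i) n f); [| lia | intros; apply H; lia].
  rewrite rsum_S, rsum_0; [ring|]. intros; apply H; lia.
Qed.

Lemma dp_eval_ext P a b : (forall i, (i < dp_bound P)%nat -> a i = b i) ->
  dp_eval P a = dp_eval P b.
Proof.
  induction P as [c|i|P IHP Q IHQ|P IHP Q IHQ]; simpl; intros H; auto.
  - rewrite IHP, IHQ; auto; intros; apply H; lia.
  - rewrite IHP, IHQ; auto; intros; apply H; lia.
Qed.

Lemma dp_partial_bound P j a : (dp_bound P <= j)%nat -> dp_eval (dp_partial j P) a = 0.
Proof.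
  induction P as [c|i|P IHP Q IHQ|P IHP Q IHQ]; simpl; intros H; auto.
  - destruct (Nat.eqb_spec i j); [lia|reflexivity].
  - rewrite IHP, IHQ by lia; ring.
  - rewrite IHP, IHQ by lia; ring.
Qed.

(** The differential of the polynomial function [dp_eval P] at [a] in the direction [h].
    With [h] the shift of [a] it is the total derivative; with [h] the time
    derivative of a jet it is the variation of the density. *)
Definition dp_diff (P : dpoly) (a h : nat -> R) : R :=
  rsum (dp_bound P) (fun j => dp_eval (dp_partial j P) a * h j).

Lemma dp_diff_bound P a h n : (dp_bound P <= n)%nat ->
  dp_diff P a h = rsum n (fun j => dp_eval (dp_partial j P) a * h j).
Proof.
  intros H. symmetry; apply rsum_extend; auto.
  intros j Hj. rewrite dp_partial_bound; auto; ring.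
Qed.

Lemma dp_diff_U i a h : dp_diff (dU i) a h = h i.
Proof.
  unfold dp_diff; simpl dp_bound. rewrite (rsum_delta _ i); [| lia |]; simpl.
  - rewrite Nat.eqb_refl; simpl; ring.
  - intros j Hj. destruct (Nat.eqb_spec i j); [congruence|]. simpl; ring.
Qed.

Lemma dp_diff_plus P Q a h : dp_diff (P + Q)%dp a h = dp_diff P a h + dp_diff Q a h.
Proof.
  rewrite (dp_diff_bound P a h (Nat.max (dp_bound P) (dp_bound Q))) by lia.
  rewrite (dp_diff_bound Q a h (Nat.max (dp_bound P) (dp_bound Q))) by lia.
  rewrite <- rsum_plus. apply rsum_ext. intros; simpl; ring.
Qed.

Lemma dp_diff_mult P Q a h :
  dp_diff (P * Q)%dp a h = dp_diff P a h * dp_eval Q a + dp_eval P a * dp_diff Q a h.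
Proof.
  rewrite (dp_diff_bound P a h (Nat.max (dp_bound P) (dp_bound Q))) by lia.
  rewrite (dp_diff_bound Q a h (Nat.max (dp_bound P) (dp_bound Q))) by lia.
  rewrite <- rsum_scal, (Rmult_comm _ (dp_eval Q a)), <- rsum_scal, <- rsum_plus.
  apply rsum_ext. intros; simpl; ring.
Qed.

Lemma is_derive_dp_eval P (a : R -> nat -> R) (h : nat -> R) t :
  (forall i, (i < dp_bound P)%nat -> is_derive (fun s => a s i) t (h i)) ->
  is_derive (fun s => dp_eval P (a s)) t (dp_diff P (a t) h).
Proof.
  induction P as [c|i|P IHP Q IHQ|P IHP Q IHQ]; simpl; intros H.
  - apply (is_derive_const (V := R_NormedModule) c).
  - rewrite dp_diff_U. apply H; lia.
  - rewrite dp_diff_plus.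
    apply (is_derive_plus (V := R_NormedModule) (fun s => dp_eval P (a s)) (fun s => dp_eval Q (a s)));
      [apply IHP | apply IHQ]; intros; apply H; lia.
  - rewrite dp_diff_mult.
    apply (is_derive_mult (fun s => dp_eval P (a s)) (fun s => dp_eval Q (a s)));
      [apply IHP | apply IHQ | intros; apply Rmult_comm]; intros; apply H; lia.
Qed.

Lemma dp_eval_delta P a : dp_eval (delta P) a = dp_diff P a (fun j => a (S j)).
Proof.
  unfold delta, dp_diff. rewrite dp_eval_sum. apply rsum_ext; intros; simpl; ring.
Qed.

Lemma is_derive_0_const (f : R -> R) a b : (forall t, is_derive f t 0) -> f a = f b.
Proof.
  intros H. destruct (MVT_gen f a b (fun _ => 0)) as (c & _ & E).
  - intros; apply H.
  - intros. apply continuity_pt_filterlim.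
    apply (ex_derive_continuous (V := R_NormedModule)). now exists 0.
  - lra.
Qed.

Definition upd (a : nat -> R) (j : nat) (y : R) : nat -> R := fun i => if Nat.eqb i j then y else a i.

Lemma upd_same a j : upd a j (a j) = a.
Proof.
  apply functional_extensionality; intros i. unfold upd. now destruct (Nat.eqb_spec i j) as [->|].
Qed.

(** Formal partial derivatives are actual ones, so they depend on a polynomial
    expression only through its values; this makes [delta] and [euler] compatible
    with [dp_eq]. *)
Lemma is_derive_dp_partial P a j y :
  is_derive (fun s => dp_eval P (upd a j s)) y (dp_eval (dp_partial j P) (upd a j y)).
Proof.
  replace (dp_eval (dp_partial j P) (upd a j y))
    with (dp_diff P (upd a j y) (fun i => if Nat.eqb i j then 1 else 0)).
  - apply (is_derive_dp_eval P (upd a j)).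
    intros i _. unfold upd. destruct (Nat.eqb i j).
    + apply (is_derive_id (K := R_AbsRing)).
    + apply (is_derive_const (V := R_NormedModule) (a i)).
  - rewrite (dp_diff_bound _ _ _ (Nat.max (S j) (dp_bound P))) by lia.
    rewrite (rsum_delta _ j); [rewrite Nat.eqb_refl; ring | lia |].
    intros i Hi. destruct (Nat.eqb_spec i j); [congruence | ring].
Qed.

Lemma dp_partial_eq P Q j : (P == Q)%dp -> (dp_partial j P == dp_partial j Q)%dp.
Proof.
  intros H a. rewrite <- (upd_same a j).
  rewrite <- (is_derive_unique _ _ _ (is_derive_dp_partial P a j (a j))).
  rewrite <- (is_derive_unique _ _ _ (is_derive_dp_partial Q a j (a j))).
  apply Derive_ext. intros; apply H.
Qed.

Lemma delta_eq P Q : (P == Q)%dp -> (delta P == delta Q)%dp.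
Proof.
  intros H a. rewrite !dp_eval_delta.
  rewrite (dp_diff_bound P a _ (Nat.max (dp_bound P) (dp_bound Q))) by lia.
  rewrite (dp_diff_bound Q a _ (Nat.max (dp_bound P) (dp_bound Q))) by lia.
  apply rsum_ext. intros j _. now rewrite (dp_partial_eq P Q j H).
Qed.

Lemma delta_C c a : dp_eval (delta (dC c)) a = 0.
Proof. reflexivity. Qed.

Lemma delta_U i a : dp_eval (delta (dU i)) a = a (S i).
Proof. now rewrite dp_eval_delta, dp_diff_U. Qed.

Lemma delta_plus P Q a : dp_eval (delta (P + Q)%dp) a = dp_eval (delta P) a + dp_eval (delta Q) a.
Proof. rewrite !dp_eval_delta. apply dp_diff_plus. Qed.

Lemma delta_mult P Q a : dp_eval (delta (P * Q)%dp) a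
   = dp_eval (delta P) a * dp_eval Q a + dp_eval P a * dp_eval (delta Q) a.
Proof. rewrite !dp_eval_delta. apply dp_diff_mult. Qed.

Lemma delta_sum n F a : dp_eval (delta (dp_sum n F)) a = rsum n (fun j => dp_eval (delta (F j)) a).
Proof.
  induction n as [|n IH]; [reflexivity|]. simpl. now rewrite delta_plus, IH.
Qed.

Lemma constant_term_delta P : constant_term (delta P) = 0.
Proof.
  unfold constant_term. rewrite dp_eval_delta. unfold dp_diff. apply rsum_0. intros; ring.
Qed.

Lemma dp_partial_local P n j a b :
  (forall a b, (forall i, (i < n)%nat -> a i = b i) -> dp_eval P a = dp_eval P b) ->
  (forall i, (i < n)%nat -> a i = b i) ->
  a j = b j -> dp_eval (dp_partial j P) a = dp_eval (dp_partial j P) b.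
Proof.
  intros H Hab Hj.
  rewrite <- (upd_same a j), <- (upd_same b j).
  rewrite <- (is_derive_unique _ _ _ (is_derive_dp_partial P a j (a j))).
  rewrite <- (is_derive_unique _ _ _ (is_derive_dp_partial P b j (b j))), Hj.
  apply Derive_ext. intros y. apply H. intros i Hi. unfold upd.
  destruct (Nat.eqb i j); auto.
Qed.

(** A polynomial in u_0, ..., u_n has a total derivative in which u_(n+1) occurs
    only in the term u_(n+1) * dP/du_n. If the total derivative vanishes, comparing
    its values at u_(n+1) = 0 and u_(n+1) = 1 gives dP/du_n = 0, so u_n does not
    occur either; descending, no variable is left. *)
Lemma delta_kernel P : (delta P == dC 0)%dp -> (P == dC (constant_term P))%dp.
Proof.
  intros H.
  (* [P] depends on the first [n] variables only, for [n] going down from the bound. *)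
  assert (Hd : forall m n, (dp_bound P <= n + m)%nat ->
     forall a b, (forall i, (i < n)%nat -> a i = b i) -> dp_eval P a = dp_eval P b).
  { intros m; induction m as [|m IH]; intros n Hn a b Hab.
    - apply dp_eval_ext. intros; apply Hab; lia.
    - assert (IHn := IH (S n) ltac:(lia)).
      assert (Hz : forall c, dp_eval (dp_partial n P) c = 0).
      { intros c.
        (* Two points differing only in the variable that occurs once in [delta P]. *)
        pose (c0 := upd c (S n) 0). pose (c1 := upd c (S n) 1).
        assert (A0 : forall i, (i < S n)%nat -> c i = c0 i).
        { intros i Hi. unfold c0, upd. now destruct (Nat.eqb_spec i (S n)); [lia|]. }
        assert (A1 : forall i, (i < S n)%nat -> c i = c1 i).
        { intros i Hi. unfold c1, upd. now destruct (Nat.eqb_spec i (S n)); [lia|]. }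
        assert (E : forall e, (forall i, (i < S n)%nat -> c i = e i) ->
          rsum n (fun j => dp_eval (dp_partial j P) c * c (S j))
             + dp_eval (dp_partial n P) c * e (S n) = 0).
        { intros e He. transitivity (dp_eval (delta P) e); [|apply H].
          rewrite dp_eval_delta, (dp_diff_bound _ _ _ (Nat.max (S n) (dp_bound P))) by lia.
          rewrite (rsum_extend (S n) (Nat.max (S n) (dp_bound P))); [| lia |].
          - rewrite rsum_S. f_equal.
            + apply rsum_ext. intros j Hj. rewrite <- He by lia. f_equal.
              apply (dp_partial_local P (S n)); auto.
            + f_equal. apply (dp_partial_local P (S n)); auto.
          - intros j Hj. 
            replace (dp_eval (dp_partial j P) e) with 0; [ring|].
            rewrite <- (upd_same e j).
            rewrite <- (is_derive_unique _ _ _ (is_derive_dp_partial P e j (e j))).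
            rewrite (Derive_ext _ (fun _ => dp_eval P e)); [symmetry; apply Derive_const|].
            intros y. apply IHn. intros i Hi. unfold upd. destruct (Nat.eqb_spec i j); [lia|auto]. }
        pose proof (E c0 A0) as E0. pose proof (E c1 A1) as E1.
        unfold c0, c1, upd in E0, E1. rewrite Nat.eqb_refl in E0, E1. cbv iota in E0, E1. lra. }
      transitivity (dp_eval P (upd a n (b n))).
      + rewrite <- (upd_same a n) at 1.
        apply (is_derive_0_const (fun s => dp_eval P (upd a n s))).
        intros y. rewrite <- (Hz (upd a n y)). apply is_derive_dp_partial.
      + apply IHn. intros i Hi. unfold upd. destruct (Nat.eqb_spec i n) as [->|]; auto.
        apply Hab; lia. }
  intros a. apply (Hd (dp_bound P) 0%nat); [lia|]. intros; lia.
Qed.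

(** * The Euler operator and the mKdV recursion *)

Definition neg_delta (P : dpoly) : dpoly := (dC (-1) * delta P)%dp.

(** The boundary term of i integrations by parts moving the total derivatives off
    the i-th derivative of u_1: F u_(i+1) = ((-delta)^i F) u_1 + delta (boundary i F). *)
Fixpoint boundary (i : nat) (F : dpoly) : dpoly :=
  match i with
  | 0%nat => dC 0
  | S i' => (boundary i' (neg_delta F) + F * dU i)%dp
  end.

Lemma delta_boundary i F a :
  dp_eval (delta (boundary i F)) a
  = dp_eval F a * a (S i) - dp_eval (Nat.iter i neg_delta F) a * a 1%nat.
Proof.
  revert F; induction i as [|i IH]; intros F.
  - simpl. unfold delta; simpl. ring.
  - rewrite Nat.iter_succ_r. simpl boundary.
    rewrite delta_plus, IH, delta_mult, delta_U.
    unfold neg_delta at 1; simpl. ring.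
Qed.

Lemma constant_term_boundary i F : constant_term (boundary i F) = 0.
Proof.
  unfold constant_term; revert F; induction i as [|i IH]; intros F; simpl; [reflexivity|].
  rewrite IH; ring.
Qed.

(** The first two terms are the energy of the Lagrangian [P], the quantity attached
    by Noether's theorem to translations in s. Adding u E(P) gives a local choice of
    delta^{-1}(u delta E P), as [delta_noether] shows, and it is the form in which
    delta^{-1} appears when the first variation of the integral of [P] is computed. *)
Definition noether (P : dpoly) : dpoly :=
  (dp_sum (dp_bound P) (fun i => boundary i (dp_partial i P)) + dC (-1) * P + dU 0 * euler P)%dp.

Lemma dp_eval_euler P a : dp_eval (euler P) a =
  rsum (dp_bound P) (fun i => dp_eval (Nat.iter i neg_delta (dp_partial i P)) a).
Proof. apply dp_eval_sum. Qed.

Lemma delta_noether P : (delta (noether P) == dU 0 * delta (euler P))%dp.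
Proof.
  intros a. unfold noether.
  rewrite !delta_plus, !delta_mult, delta_U, delta_sum, delta_C. simpl.
  rewrite (rsum_ext _ _ (fun i => dp_eval (dp_partial i P) a * a (S i)
      + (- a 1%nat) * dp_eval (Nat.iter i neg_delta (dp_partial i P)) a))
    by (intros; rewrite delta_boundary; ring).
  rewrite rsum_plus, rsum_scal, <- dp_eval_euler, dp_eval_delta.
  unfold dp_diff. ring.
Qed.

Lemma constant_term_noether P : constant_term (noether P) = - constant_term P.
Proof.
  unfold constant_term, noether. simpl. rewrite dp_eval_sum, rsum_0; [ring|].
  intros; apply constant_term_boundary.
Qed.

Lemma delta_eq_up_to_constant P Q :
  (delta P == delta Q)%dp -> (P == Q + dC (constant_term P - constant_term Q))%dp.
Proof.
  intros H a.
  assert (E : (delta (P + dC (-1) * Q) == dC 0)%dp).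
  { intros b. rewrite delta_plus, delta_mult, delta_C, H. simpl. ring. }
  pose proof (delta_kernel _ E a) as K. unfold constant_term in *. simpl in *. lra.
Qed.

Lemma constant_term_euler_hierarchy rho M N Lam j :
  mKdV_hierarchy rho M N Lam -> (1 <= j)%nat -> constant_term (euler (rho j)) = 0.
Proof.
  intros [_ H] Hj. destruct (H j Hj) as (_ & HL & HL0 & _).
  unfold constant_term in *. rewrite HL in HL0. simpl in HL0. lra.
Qed.

(** Both sides are antiderivatives of u M_j. They differ by the constant term of
    rho_j, which the hierarchy leaves free for j > 1 and the integral of rho_j
    detects. *)
Lemma noether_hierarchy rho M N Lam j :
  mKdV_hierarchy rho M N Lam -> (1 <= j)%nat ->
  (noether (rho j) == N j + dC (- constant_term (rho j)))%dp.
Proof.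
  intros [_ H] Hj a. destruct (H j Hj) as (HM & _ & _ & HN & HN0 & _).
  rewrite (delta_eq_up_to_constant (noether (rho j)) (N j)).
  - rewrite constant_term_noether, HN0. simpl. ring.
  - intros b. rewrite delta_noether, HN. simpl. now rewrite HM.
Qed.

(** The recursion for [delta (euler (rho (S j)))] can be integrated once, because the
    normalisation of [Lam] forbids a constant term in [euler (rho (S j))]. *)
Lemma euler_hierarchy rho M N Lam j :
  mKdV_hierarchy rho M N Lam -> (1 <= j)%nat ->
  (euler (rho (S j)) == delta (delta (euler (rho j))) + dU 0 * N j)%dp.
Proof.
  intros HH Hj a.
  pose proof (constant_term_euler_hierarchy _ _ _ _ (S j) HH ltac:(lia)) as C0.
  destruct HH as [_ H]. destruct (H j Hj) as (_ & _ & _ & _ & _ & HE).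
  rewrite (delta_eq_up_to_constant _ (delta (delta (euler (rho j))) + dU 0 * N j)%dp).
  - rewrite C0. pose proof (constant_term_delta (delta (euler (rho j)))) as C1.
    unfold constant_term in *. simpl. rewrite C1. ring.
  - intros b. now rewrite HE, delta_plus.
Qed.

Lemma iter_neg_delta_eq i P Q :
  (P == Q)%dp -> (Nat.iter i neg_delta P == Nat.iter i neg_delta Q)%dp.
Proof.
  intros H; induction i as [|i IH]; simpl; auto.
  intros a. simpl. now rewrite (delta_eq _ _ IH).
Qed.

Lemma dp_eval_euler_bound P a n : (dp_bound P <= n)%nat -> dp_eval (euler P) a =
  rsum n (fun i => dp_eval (Nat.iter i neg_delta (dp_partial i P)) a).
Proof.
  intros Hn. rewrite dp_eval_euler. symmetry; apply rsum_extend; auto.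
  intros i Hi. rewrite (iter_neg_delta_eq i _ (dC 0)).
  - clear. induction i as [|i IH]; [reflexivity|]. rewrite Nat.iter_succ_r.
    rewrite (iter_neg_delta_eq i _ (dC 0)); auto.
    intros b; unfold neg_delta; simpl; ring.
  - intros b. now apply dp_partial_bound.
Qed.

Lemma euler_eq P Q : (P == Q)%dp -> (euler P == euler Q)%dp.
Proof.
  intros H a.
  rewrite (dp_eval_euler_bound P a (Nat.max (dp_bound P) (dp_bound Q))) by lia.
  rewrite (dp_eval_euler_bound Q a (Nat.max (dp_bound P) (dp_bound Q))) by lia.
  apply rsum_ext. intros i _. now apply iter_neg_delta_eq, dp_partial_eq.
Qed.

Lemma euler_rho_1 rho M N Lam :
  mKdV_hierarchy rho M N Lam -> (euler (rho 1%nat) == dU 0)%dp.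
Proof.
  intros [H _] a. rewrite (euler_eq _ _ H). unfold euler. simpl. field.
Qed.

(** * Families of periodic Legendrian curves *)

Lemma Re_herm z w : Re (herm z w) =
  coord z 0 * coord w 0 + coord z 1 * coord w 1 + coord z 2 * coord w 2 + coord z 3 * coord w 3.
Proof. destruct z as [[a b] [c d]], w as [[a' b'] [c' d']]. simpl. ring. Qed.

Lemma Im_herm z w : Im (herm z w) =
  coord z 1 * coord w 0 - coord z 0 * coord w 1 + coord z 3 * coord w 2 - coord z 2 * coord w 3.
Proof. destruct z as [[a b] [c d]], w as [[a' b'] [c' d']]. simpl. ring. Qed.

Lemma coord_D g x i : coord (D g x) i = Derive (fun y => coord (g y) i) x.
Proof. destruct i as [|[|[|i]]]; reflexivity. Qed.

Lemma coord_velocity G t x i : coord (velocity G t x) i = Derive (fun u => coord (G u x) i) t.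
Proof. apply coord_D. Qed.

Lemma normsq_coord g x : normsq g x =
  Derive (fun y => coord (g y) 0) x ^ 2 + Derive (fun y => coord (g y) 1) x ^ 2
  + Derive (fun y => coord (g y) 2) x ^ 2 + Derive (fun y => coord (g y) 3) x ^ 2.
Proof. unfold normsq. rewrite Re_herm, !coord_D. ring. Qed.

Lemma normsq_pos L g x : PL L g -> 0 < normsq g x.
Proof.
  intros (_ & _ & Hn & _). specialize (Hn x).
  assert (E : herm (D g x) (D g x) = RtoC (normsq g x)).
  { unfold normsq. apply injective_projections; simpl; [reflexivity|]. ring. }
  assert (normsq g x <> 0) by (intros H; apply Hn; now rewrite E, H).
  assert (0 <= normsq g x) by (rewrite normsq_coord; repeat apply Rplus_le_le_0_compat; apply pow2_ge_0).
  lra.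
Qed.

Lemma speed_pos L g x : PL L g -> 0 < speed g x.
Proof. intros H. apply sqrt_lt_R0. now apply (normsq_pos L). Qed.

Lemma speed_sqr L g x : PL L g -> speed g x * speed g x = normsq g x.
Proof. intros H. apply sqrt_sqrt. apply Rlt_le. now apply (normsq_pos L). Qed.

(** The numerator of the curvature, equal to k v^3 for speed v. It is a polynomial in
    the derivatives of the coordinates, which makes it easier to vary than k. *)
Definition twist (g : curve) (x : R) : R := Im (herm (D (D g) x) (D g x)).

Definition coord_family (G : R -> curve) (i : nat) : R -> R -> R := fun t x => coord (G t x) i.

Lemma normsq_family G t x : normsq (G t) x =
  dx (coord_family G 0) t x ^ 2 + dx (coord_family G 1) t x ^ 2 + dx (coord_family G 2) t x ^ 2 + dx (coord_family G 3) t x ^ 2.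
Proof. apply normsq_coord. Qed.

Lemma coord_DD g i x : coord (D (D g) x) i = Derive (Derive (fun z => coord (g z) i)) x.
Proof. rewrite coord_D. apply Derive_ext. intros; apply coord_D. Qed.

Lemma twist_family G t x : twist (G t) x =
  dx (dx (coord_family G 1)) t x * dx (coord_family G 0) t x - dx (dx (coord_family G 0)) t x * dx (coord_family G 1) t x
  + dx (dx (coord_family G 3)) t x * dx (coord_family G 2) t x - dx (dx (coord_family G 2)) t x * dx (coord_family G 3) t x.
Proof. unfold twist. rewrite Im_herm, !coord_DD, !coord_D. reflexivity. Qed.

Lemma functional_extensionality2 (F G : R -> R -> R) : (forall t x, F t x = G t x) -> F = G.
Proof. intros H. apply functional_extensionality; intros t; apply functional_extensionality; auto. Qed.

Ltac smooth2_tac := repeat (first [ assumption | apply smooth2_const | apply smooth2_pow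
  | apply smooth2_minus | apply smooth2_plus | apply smooth2_mult | apply smooth2_dx ]).

Lemma smooth2_normsq L G : smooth_path L G -> smooth2 (fun t x => normsq (G t) x).
Proof.
  intros [HG _]. rewrite (functional_extensionality2 _ _ (normsq_family G)).
  smooth2_tac; exact (HG _).
Qed.

Lemma smooth2_twist L G : smooth_path L G -> smooth2 (fun t x => twist (G t) x).
Proof.
  intros [HG _]. rewrite (functional_extensionality2 _ _ (twist_family G)).
  smooth2_tac; exact (HG _).
Qed.

Lemma smooth2_inv_speed L G : smooth_path L G -> smooth2 (fun t x => / speed (G t) x).
Proof.
  intros HG. apply smooth2_inv_sqrt.
  - intros t x. apply (normsq_pos L). apply HG.
  - now apply (smooth2_normsq L).
Qed.

Lemma smooth2_speed L G : smooth_path L G -> smooth2 (fun t x => speed (G t) x).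
Proof.
  intros HG.
  rewrite (functional_extensionality2 _ (fun t x => normsq (G t) x * / speed (G t) x)).
  - apply smooth2_mult; [now apply (smooth2_normsq L) | now apply (smooth2_inv_speed L)].
  - intros t x. destruct HG as [_ HP]. pose proof (speed_pos L _ x (HP t)).
    rewrite <- (speed_sqr L) by auto. field. lra.
Qed.

Lemma smooth2_curvature L G : smooth_path L G -> smooth2 (fun t x => curvature (G t) x).
Proof.
  intros HG.
  rewrite (functional_extensionality2 _ (fun t x => twist (G t) x * (/ speed (G t) x) ^ 3)).
  - apply smooth2_mult; [now apply (smooth2_twist L) | apply smooth2_pow; now apply (smooth2_inv_speed L)].
  - intros t x. unfold curvature, twist, Rdiv. now rewrite pow_inv.
Qed.

Lemma jet_S g x i : jet g x (S i) = / speed g x * Derive (fun y => jet g y i) x.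
Proof. reflexivity. Qed.

Lemma smooth2_jet L G i : smooth_path L G -> smooth2 (fun t x => jet (G t) x i).
Proof.
  intros HG; induction i as [|i IH].
  - now apply (smooth2_curvature L).
  - apply (smooth2_mult (fun t x => / speed (G t) x) (dx (fun t x => jet (G t) x i))).
    + now apply (smooth2_inv_speed L).
    + now apply smooth2_dx.
Qed.

Lemma smooth2_dp_eval L G P : smooth_path L G -> smooth2 (fun t x => dp_eval P (jet (G t) x)).
Proof.
  intros HG; induction P as [c|i|P IHP Q IHQ|P IHP Q IHQ]; simpl.
  - apply smooth2_const.
  - now apply (smooth2_jet L).
  - now apply smooth2_plus.
  - now apply smooth2_mult.
Qed.

Lemma smooth_path_const L g : PL L g -> smooth_path L (fun _ => g).
Proof. intros H; split; auto. intros i. apply (smooth_lift (fun x => coord (g x) i)). apply H. Qed.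

Lemma smooth_jet L g i : PL L g -> smooth (fun x => jet g x i).
Proof. intros H. apply (smooth_slice (fun _ x => jet g x i) 0). now apply (smooth2_jet L _ i (smooth_path_const L g H)). Qed.

Lemma smooth_dp_eval L g P : PL L g -> smooth (fun x => dp_eval P (jet g x)).
Proof. intros H. apply (smooth_slice (fun _ x => dp_eval P (jet g x)) 0). now apply (smooth2_dp_eval L _ P (smooth_path_const L g H)). Qed.

Lemma smooth_normsq L g : PL L g -> smooth (normsq g).
Proof. intros H. apply (smooth_slice (fun _ => normsq g) 0). now apply (smooth2_normsq L _ (smooth_path_const L g H)). Qed.

Lemma smooth_speed L g : PL L g -> smooth (speed g).
Proof. intros H. apply (smooth_slice (fun _ => speed g) 0). now apply (smooth2_speed L _ (smooth_path_const L g H)). Qed.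

Lemma smooth_inv_speed L g : PL L g -> smooth (fun x => / speed g x).
Proof. intros H. apply (smooth_slice (fun _ x => / speed g x) 0). now apply (smooth2_inv_speed L _ (smooth_path_const L g H)). Qed.

Lemma D_periodic L g : (forall x, g (x + L) = g x) -> forall x, D g (x + L) = D g x.
Proof.
  intros H x. unfold D.
  assert (E : forall i, Derive (fun y => coord (g y) i) (x + L) = Derive (fun y => coord (g y) i) x).
  { intros i. apply (periodic_Derive L (fun y => coord (g y) i)). intros y; now rewrite H. }
  now rewrite !E.
Qed.

Lemma periodic_normsq L g : PL L g -> periodic L (normsq g).
Proof. intros (_ & _ & _ & _ & H) x. unfold normsq. now rewrite (D_periodic L). Qed.

Lemma periodic_speed L g : PL L g -> periodic L (speed g).
Proof. intros H x. unfold speed. now rewrite (periodic_normsq L g H). Qed.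

Lemma periodic_jet L g i : PL L g -> periodic L (fun x => jet g x i).
Proof.
  intros H; induction i as [|i IH]; intros x.
  - change (curvature g (x + L) = curvature g x). unfold curvature.
    rewrite (periodic_speed L g H). destruct H as (_ & _ & _ & _ & H).
    now rewrite (D_periodic L (D g) (D_periodic L g H)), (D_periodic L g H).
  - rewrite !jet_S, (periodic_speed L g H). f_equal. now apply (periodic_Derive L).
Qed.

Lemma periodic_dp_eval L g P : PL L g -> periodic L (fun x => dp_eval P (jet g x)).
Proof.
  intros H x. f_equal. apply functional_extensionality; intros i. now apply (periodic_jet L g i).
Qed.

Lemma Derive_dp_eval L g P x : PL L g ->
  Derive (fun y => dp_eval P (jet g y)) x = speed g x * dp_eval (delta P) (jet g x).
Proof.
  intros H. pose proof (speed_pos L g x H).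
  apply is_derive_unique.
  replace (speed g x * dp_eval (delta P) (jet g x))
    with (dp_diff P (jet g x) (fun i => speed g x * jet g x (S i))).
  - apply (is_derive_dp_eval P (jet g)). intros i _. rewrite jet_S.
    replace (speed g x * (/ speed g x * Derive (fun y => jet g y i) x))
      with (Derive (fun y => jet g y i) x) by (field; lra).
    apply Derive_correct, smooth_ex_derive. now apply (smooth_jet L).
  - rewrite dp_eval_delta. unfold dp_diff. rewrite <- rsum_scal. apply rsum_ext; intros; ring.
Qed.

(** * Variation of speed and curvature *)

Lemma is_derive_sum_squares (f0 f1 f2 f3 : R -> R) s :
  ex_derive f0 s -> ex_derive f1 s -> ex_derive f2 s -> ex_derive f3 s ->
  is_derive (fun s => f0 s ^ 2 + f1 s ^ 2 + f2 s ^ 2 + f3 s ^ 2) s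
    (2 * (f0 s * Derive f0 s + f1 s * Derive f1 s + f2 s * Derive f2 s + f3 s * Derive f3 s)).
Proof.
  intros. auto_derive; [tauto|].
  change (Derive (fun x => f0 x)) with (Derive f0). change (Derive (fun x => f1 x)) with (Derive f1).
  change (Derive (fun x => f2 x)) with (Derive f2). change (Derive (fun x => f3 x)) with (Derive f3). ring.
Qed.

Lemma is_derive_re_herm (f0 f1 f2 f3 h0 h1 h2 h3 : R -> R) s :
  ex_derive f0 s -> ex_derive f1 s -> ex_derive f2 s -> ex_derive f3 s ->
  ex_derive h0 s -> ex_derive h1 s -> ex_derive h2 s -> ex_derive h3 s ->
  is_derive (fun s => f0 s * h0 s + f1 s * h1 s + f2 s * h2 s + f3 s * h3 s) s
    ((Derive f0 s * h0 s + Derive f1 s * h1 s + Derive f2 s * h2 s + Derive f3 s * h3 s)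
    + (f0 s * Derive h0 s + f1 s * Derive h1 s + f2 s * Derive h2 s + f3 s * Derive h3 s)).
Proof.
  intros. auto_derive; [tauto|].
  change (Derive (fun x => f0 x)) with (Derive f0). change (Derive (fun x => f1 x)) with (Derive f1).
  change (Derive (fun x => f2 x)) with (Derive f2). change (Derive (fun x => f3 x)) with (Derive f3).
  change (Derive (fun x => h0 x)) with (Derive h0). change (Derive (fun x => h1 x)) with (Derive h1).
  change (Derive (fun x => h2 x)) with (Derive h2). change (Derive (fun x => h3 x)) with (Derive h3). ring.
Qed.

Lemma is_derive_im_herm (f0 f1 f2 f3 h0 h1 h2 h3 : R -> R) s :
  ex_derive f0 s -> ex_derive f1 s -> ex_derive f2 s -> ex_derive f3 s ->
  ex_derive h0 s -> ex_derive h1 s -> ex_derive h2 s -> ex_derive h3 s ->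
  is_derive (fun s => f1 s * h0 s - f0 s * h1 s + f3 s * h2 s - f2 s * h3 s) s
    ((Derive f1 s * h0 s - Derive f0 s * h1 s + Derive f3 s * h2 s - Derive f2 s * h3 s)
    + (f1 s * Derive h0 s - f0 s * Derive h1 s + f3 s * Derive h2 s - f2 s * Derive h3 s)).
Proof.
  intros. auto_derive; [tauto|].
  change (Derive (fun x => f0 x)) with (Derive f0). change (Derive (fun x => f1 x)) with (Derive f1).
  change (Derive (fun x => f2 x)) with (Derive f2). change (Derive (fun x => f3 x)) with (Derive f3).
  change (Derive (fun x => h0 x)) with (Derive h0). change (Derive (fun x => h1 x)) with (Derive h1).
  change (Derive (fun x => h2 x)) with (Derive h2). change (Derive (fun x => h3 x)) with (Derive h3). ring.
Qed.

(** Each real coordinate of p g_x + q (i g_x) + r (i g) has the form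
    p a' + e (q b' + r b), where [b] is the other real coordinate in the same complex
    line and [e] is 1 or -1. *)
Lemma is_derive_velocity_coord (p q r a b : R -> R) e x :
  smooth p -> smooth q -> smooth r -> smooth a -> smooth b ->
  is_derive (fun x => p x * Derive a x + e * (q x * Derive b x + r x * b x)) x
   (Derive p x * Derive a x + p x * Derive (Derive a) x
    + e * (Derive q x * Derive b x + q x * Derive (Derive b) x + Derive r x * b x + r x * Derive b x)).
Proof.
  intros Hp Hq Hr Ha Hb.
  pose proof (smooth_ex_derive _ x Hp). pose proof (smooth_ex_derive _ x Hq).
  pose proof (smooth_ex_derive _ x Hr). pose proof (smooth_ex_derive _ x Hb).
  pose proof (smooth_ex_derive _ x (smooth_Derive _ Ha)).
  pose proof (smooth_ex_derive _ x (smooth_Derive _ Hb)).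
  remember (Derive a) as a' eqn:Ea. remember (Derive b) as b' eqn:Eb.
  auto_derive; [tauto|]. 
  change (Derive (fun x => p x)) with (Derive p). change (Derive (fun x => q x)) with (Derive q).
  change (Derive (fun x => r x)) with (Derive r). change (Derive (fun x => b x)) with (Derive b).
  change (Derive (fun x => a' x)) with (Derive a'). change (Derive (fun x => b' x)) with (Derive b').
  rewrite <- Eb. ring.
Qed.

Lemma is_derive_velocity_coord_deriv (p q r a b : R -> R) e x :
  smooth p -> smooth q -> smooth r -> smooth a -> smooth b ->
  is_derive (fun x => Derive p x * Derive a x + p x * Derive (Derive a) x
    + e * (Derive q x * Derive b x + q x * Derive (Derive b) x + Derive r x * b x + r x * Derive b x)) x
   (Derive (Derive p) x * Derive a x + 2 * Derive p x * Derive (Derive a) x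
      + p x * Derive (Derive (Derive a)) x
    + e * (Derive (Derive q) x * Derive b x + 2 * Derive q x * Derive (Derive b) x
         + q x * Derive (Derive (Derive b)) x
         + Derive (Derive r) x * b x + 2 * Derive r x * Derive b x + r x * Derive (Derive b) x)).
Proof.
  intros Hp Hq Hr Ha Hb.
  pose proof (smooth_ex_derive _ x Hp). pose proof (smooth_ex_derive _ x Hq).
  pose proof (smooth_ex_derive _ x Hr). pose proof (smooth_ex_derive _ x Hb).
  pose proof (smooth_ex_derive _ x (smooth_Derive _ Hp)).
  pose proof (smooth_ex_derive _ x (smooth_Derive _ Hq)).
  pose proof (smooth_ex_derive _ x (smooth_Derive _ Hr)).
  pose proof (smooth_ex_derive _ x (smooth_Derive _ Ha)).
  pose proof (smooth_ex_derive _ x (smooth_Derive _ Hb)).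
  pose proof (smooth_ex_derive _ x (smooth_Derive _ (smooth_Derive _ Ha))).
  pose proof (smooth_ex_derive _ x (smooth_Derive _ (smooth_Derive _ Hb))).
  remember (Derive (Derive a)) as a'' eqn:Ea2. remember (Derive (Derive b)) as b'' eqn:Eb2.
  remember (Derive a) as a' eqn:Ea. remember (Derive b) as b' eqn:Eb.
  remember (Derive p) as p' eqn:Ep. remember (Derive q) as q' eqn:Eq. remember (Derive r) as r' eqn:Er.
  auto_derive; [tauto|].
  change (Derive (fun x => p x)) with (Derive p). change (Derive (fun x => q x)) with (Derive q).
  change (Derive (fun x => r x)) with (Derive r). change (Derive (fun x => b x)) with (Derive b).
  change (Derive (fun x => a' x)) with (Derive a'). change (Derive (fun x => b' x)) with (Derive b').
  change (Derive (fun x => a'' x)) with (Derive a''). change (Derive (fun x => b'' x)) with (Derive b'').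
  change (Derive (fun x => p' x)) with (Derive p'). change (Derive (fun x => q' x)) with (Derive q').
  change (Derive (fun x => r' x)) with (Derive r').
  rewrite <- Eb, <- Ea2, <- Eb2, <- Ep, <- Eq, <- Er. ring.
Qed.

Definition frame_field (g : curve) (p q r : R -> R) : curve := fun x =>
  (p x *r: D g x + q x *r: (Ci *: D g x) + r x *r: (Ci *: g x))%C2.

Lemma coord_frame_field g p q r i x : coord (frame_field g p q r x) i =
  match i with
  | 0%nat => p x * coord (D g x) 0 + -1 * (q x * coord (D g x) 1 + r x * coord (g x) 1)
  | 1%nat => p x * coord (D g x) 1 + 1 * (q x * coord (D g x) 0 + r x * coord (g x) 0)
  | 2%nat => p x * coord (D g x) 2 + -1 * (q x * coord (D g x) 3 + r x * coord (g x) 3)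
  | _ => p x * coord (D g x) 3 + 1 * (q x * coord (D g x) 2 + r x * coord (g x) 2)
  end.
Proof.
  unfold frame_field. generalize (D g x). intros w.
  destruct (g x) as [[a b] [c d]], w as [[a' b'] [c' d']].
  destruct i as [|[|[|i]]]; simpl; ring.
Qed.

(** The unit length and Legendrian conditions say that (g, g_x) is a Hermitian
    orthogonal frame; these are their real and imaginary parts. *)
Lemma legendrian_relations L g x (c := fun i y => coord (g y) i) : PL L g ->
  c 0%nat x ^ 2 + c 1%nat x ^ 2 + c 2%nat x ^ 2 + c 3%nat x ^ 2 = 1 /\
  Derive (c 0%nat) x * c 0%nat x + Derive (c 1%nat) x * c 1%nat x
    + Derive (c 2%nat) x * c 2%nat x + Derive (c 3%nat) x * c 3%nat x = 0 /\
  Derive (c 1%nat) x * c 0%nat x - Derive (c 0%nat) x * c 1%nat x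
    + Derive (c 3%nat) x * c 2%nat x - Derive (c 2%nat) x * c 3%nat x = 0.
Proof.
  intros (_ & H1 & _ & H2 & _). specialize (H1 x). specialize (H2 x).
  repeat apply conj.
  - transitivity (Re (herm (g x) (g x))); [rewrite Re_herm; unfold c; ring | now rewrite H1].
  - transitivity (Re (herm (D g x) (g x))); [rewrite Re_herm, !coord_D; reflexivity | now rewrite H2].
  - transitivity (Im (herm (D g x) (g x))); [rewrite Im_herm, !coord_D; reflexivity | now rewrite H2].
Qed.

Lemma legendrian_relations_deriv L g x (c := fun i y => coord (g y) i) : PL L g ->
  Derive (Derive (c 0%nat)) x * c 0%nat x + Derive (Derive (c 1%nat)) x * c 1%nat x
    + Derive (Derive (c 2%nat)) x * c 2%nat x + Derive (Derive (c 3%nat)) x * c 3%nat x = - normsq g x /\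
  Derive (Derive (c 1%nat)) x * c 0%nat x - Derive (Derive (c 0%nat)) x * c 1%nat x
    + Derive (Derive (c 3%nat)) x * c 2%nat x - Derive (Derive (c 2%nat)) x * c 3%nat x = 0.
Proof.
  intros HP.
  assert (S : forall i, smooth (c i)) by (intros; apply HP).
  assert (S0 : forall i, ex_derive (c i) x) by (intros; now apply smooth_ex_derive).
  assert (S1 : forall i, ex_derive (Derive (c i)) x) by (intros; now apply smooth_ex_derive, smooth_Derive).
  split.
  - pose proof (is_derive_re_herm _ _ _ _ _ _ _ _ x (S1 0%nat) (S1 1%nat) (S1 2%nat) (S1 3%nat)
      (S0 0%nat) (S0 1%nat) (S0 2%nat) (S0 3%nat)) as E.
    apply is_derive_unique in E.
    rewrite (Derive_ext _ (fun _ => 0)), Derive_const in E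
      by (intros y; apply (legendrian_relations L g y HP)).
    rewrite normsq_coord. fold (c 0%nat) (c 1%nat) (c 2%nat) (c 3%nat). lra.
  - pose proof (is_derive_im_herm _ _ _ _ _ _ _ _ x (S1 0%nat) (S1 1%nat) (S1 2%nat) (S1 3%nat)
      (S0 0%nat) (S0 1%nat) (S0 2%nat) (S0 3%nat)) as E.
    apply is_derive_unique in E.
    rewrite (Derive_ext _ (fun _ => 0)), Derive_const in E
      by (intros y; apply (legendrian_relations L g y HP)).
    lra.
Qed.

Lemma twist_coord g x (c := fun i y => coord (g y) i) : twist g x =
  Derive (Derive (c 1%nat)) x * Derive (c 0%nat) x - Derive (Derive (c 0%nat)) x * Derive (c 1%nat) x
  + Derive (Derive (c 3%nat)) x * Derive (c 2%nat) x - Derive (Derive (c 2%nat)) x * Derive (c 3%nat) x.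
Proof. unfold twist. rewrite Im_herm, !coord_DD, !coord_D. reflexivity. Qed.

Lemma Derive_normsq g x (c := fun i y => coord (g y) i) : smooth_curve g ->
  Derive (normsq g) x =
  2 * (Derive (c 0%nat) x * Derive (Derive (c 0%nat)) x + Derive (c 1%nat) x * Derive (Derive (c 1%nat)) x
     + Derive (c 2%nat) x * Derive (Derive (c 2%nat)) x + Derive (c 3%nat) x * Derive (Derive (c 3%nat)) x).
Proof.
  intros Hg.
  assert (S1 : forall i, ex_derive (Derive (c i)) x)
    by (intros; now apply smooth_ex_derive, smooth_Derive; apply Hg).
  rewrite (Derive_ext _ _ _ (normsq_coord g)).
  apply is_derive_unique.
  exact (is_derive_sum_squares _ _ _ _ x (S1 0%nat) (S1 1%nat) (S1 2%nat) (S1 3%nat)).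
Qed.

Lemma Derive2_normsq g x (c := fun i y => coord (g y) i) : smooth_curve g ->
  Derive (Derive (normsq g)) x =
  2 * (Derive (Derive (c 0%nat)) x ^ 2 + Derive (Derive (c 1%nat)) x ^ 2
     + Derive (Derive (c 2%nat)) x ^ 2 + Derive (Derive (c 3%nat)) x ^ 2
     + Derive (c 0%nat) x * Derive (Derive (Derive (c 0%nat))) x
     + Derive (c 1%nat) x * Derive (Derive (Derive (c 1%nat))) x
     + Derive (c 2%nat) x * Derive (Derive (Derive (c 2%nat))) x
     + Derive (c 3%nat) x * Derive (Derive (Derive (c 3%nat))) x).
Proof.
  intros Hg.
  assert (S1 : forall i, ex_derive (Derive (c i)) x)
    by (intros; now apply smooth_ex_derive, smooth_Derive; apply Hg).
  assert (S2 : forall i, ex_derive (Derive (Derive (c i))) x)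
    by (intros; apply smooth_ex_derive, smooth_Derive, smooth_Derive; apply Hg).
  rewrite (Derive_ext _ _ _ (fun y => Derive_normsq g y Hg)), Derive_scal.
  f_equal.
  etransitivity; [apply (is_derive_unique _ _ _ (is_derive_re_herm _ _ _ _ _ _ _ _ x
    (S1 0%nat) (S1 1%nat) (S1 2%nat) (S1 3%nat) (S2 0%nat) (S2 1%nat) (S2 2%nat) (S2 3%nat)))|].
  unfold c. ring.
Qed.

Lemma Derive_twist g x (c := fun i y => coord (g y) i) : smooth_curve g ->
  Derive (twist g) x =
    Derive (Derive (Derive (c 1%nat))) x * Derive (c 0%nat) x
  - Derive (Derive (Derive (c 0%nat))) x * Derive (c 1%nat) x
  + Derive (Derive (Derive (c 3%nat))) x * Derive (c 2%nat) x
  - Derive (Derive (Derive (c 2%nat))) x * Derive (c 3%nat) x.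
Proof.
  intros Hg.
  assert (S1 : forall i, ex_derive (Derive (c i)) x)
    by (intros; now apply smooth_ex_derive, smooth_Derive; apply Hg).
  assert (S2 : forall i, ex_derive (Derive (Derive (c i))) x)
    by (intros; apply smooth_ex_derive, smooth_Derive, smooth_Derive; apply Hg).
  rewrite (Derive_ext _ _ _ (twist_coord g)).
  etransitivity; [apply (is_derive_unique _ _ _ (is_derive_im_herm _ _ _ _ _ _ _ _ x
    (S2 0%nat) (S2 1%nat) (S2 2%nat) (S2 3%nat) (S1 0%nat) (S1 1%nat) (S1 2%nat) (S1 3%nat)))|].
  unfold c. ring.
Qed.

(** Three vectors of C^2 have a vanishing Gram determinant. For a unit vector [a], a
    vector [b] orthogonal to it and any [w] this is Parseval's identity in the
    frame (a, b), multiplied by the squared norm of [b]. *)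
Lemma gram_C2 (a0 a1 a2 a3 b0 b1 b2 b3 w0 w1 w2 w3 : R) :
  a0 ^ 2 + a1 ^ 2 + a2 ^ 2 + a3 ^ 2 = 1 ->
  b0 * a0 + b1 * a1 + b2 * a2 + b3 * a3 = 0 ->
  b1 * a0 - b0 * a1 + b3 * a2 - b2 * a3 = 0 ->
  (b0 ^ 2 + b1 ^ 2 + b2 ^ 2 + b3 ^ 2) * (w0 ^ 2 + w1 ^ 2 + w2 ^ 2 + w3 ^ 2) =
    (w0 * b0 + w1 * b1 + w2 * b2 + w3 * b3) ^ 2
  + (w1 * b0 - w0 * b1 + w3 * b2 - w2 * b3) ^ 2
  + (b0 ^ 2 + b1 ^ 2 + b2 ^ 2 + b3 ^ 2) *
    ((w0 * a0 + w1 * a1 + w2 * a2 + w3 * a3) ^ 2 + (w1 * a0 - w0 * a1 + w3 * a2 - w2 * a3) ^ 2).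
Proof.
  intros H1 H2 H3.
  pose (m := b0 ^ 2 + b1 ^ 2 + b2 ^ 2 + b3 ^ 2).
  pose (h := w0 ^ 2 + w1 ^ 2 + w2 ^ 2 + w3 ^ 2).
  pose (wbr := w0 * b0 + w1 * b1 + w2 * b2 + w3 * b3).
  pose (wbi := w1 * b0 - w0 * b1 + w3 * b2 - w2 * b3).
  pose (war := w0 * a0 + w1 * a1 + w2 * a2 + w3 * a3).
  pose (wai := w1 * a0 - w0 * a1 + w3 * a2 - w2 * a3).
  (* The Gram determinant of a, b, w vanishes identically; the right side collects
     the terms containing the Hermitian product of b and a. *)
  assert (E : (a0 ^ 2 + a1 ^ 2 + a2 ^ 2 + a3 ^ 2) * (m * h - wbr ^ 2 - wbi ^ 2) - m * (war ^ 2 + wai ^ 2)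
   = (b0 * a0 + b1 * a1 + b2 * a2 + b3 * a3) *
       (h * (b0 * a0 + b1 * a1 + b2 * a2 + b3 * a3) - 2 * (wbr * war + wbi * wai))
   + (b1 * a0 - b0 * a1 + b3 * a2 - b2 * a3) *
       (h * (b1 * a0 - b0 * a1 + b3 * a2 - b2 * a3) - 2 * (wbr * wai - wbi * war))).
  { unfold m, h, wbr, wbi, war, wai. ring. }
  rewrite H1, H2, H3 in E. unfold m, h, wbr, wbi, war, wai in E. lra.
Qed.

(** Coordinate [j] of i z is [partner_sign j] times coordinate [partner j] of z. *)
Definition partner (i : nat) : nat := match i with 0 => 1 | 1 => 0 | 2 => 3 | _ => 2 end%nat.
Definition partner_sign (i : nat) : R := match i with 0%nat | 2%nat => -1 | _ => 1 end.

Lemma dt_coord L G t0 p q r i : smooth_path L G -> (i < 4)%nat ->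
  (forall x, velocity G t0 x = frame_field (G t0) p q r x) ->
  dt (coord_family G i) t0 = fun x =>
    p x * Derive (coord_family G i t0) x
    + partner_sign i * (q x * Derive (coord_family G (partner i) t0) x + r x * coord_family G (partner i) t0 x).
Proof.
  intros HG Hi HV. apply functional_extensionality; intros x.
  transitivity (coord (frame_field (G t0) p q r x) i).
  - rewrite <- HV, coord_velocity. reflexivity.
  - rewrite coord_frame_field, !coord_D.
    destruct i as [|[|[|[|i]]]]; [reflexivity .. | lia].
Qed.

Lemma dt_dx_coord L G t0 p q r i x (c := fun i => coord_family G i t0) : smooth_path L G -> (i < 4)%nat ->
  smooth p -> smooth q -> smooth r ->
  (forall x, velocity G t0 x = frame_field (G t0) p q r x) ->
  dt (dx (coord_family G i)) t0 x =
    Derive p x * Derive (c i) x + p x * Derive (Derive (c i)) x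
    + partner_sign i * (Derive q x * Derive (c (partner i)) x + q x * Derive (Derive (c (partner i))) x
      + Derive r x * c (partner i) x + r x * Derive (c (partner i)) x).
Proof.
  intros HG Hi Hp Hq Hr HV.
  rewrite dt_dx by apply HG.
  assert (S : forall i, smooth (c i)) by (intros; apply smooth_slice; apply HG).
  unfold dx. rewrite (dt_coord L G t0 p q r i HG Hi HV).
  apply is_derive_unique. now apply is_derive_velocity_coord.
Qed.

Lemma dt_dx_dx_coord L G t0 p q r i x (c := fun i => coord_family G i t0) : smooth_path L G -> (i < 4)%nat ->
  smooth p -> smooth q -> smooth r ->
  (forall x, velocity G t0 x = frame_field (G t0) p q r x) ->
  dt (dx (dx (coord_family G i))) t0 x =
    Derive (Derive p) x * Derive (c i) x + 2 * Derive p x * Derive (Derive (c i)) x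
      + p x * Derive (Derive (Derive (c i))) x
    + partner_sign i * (Derive (Derive q) x * Derive (c (partner i)) x
         + 2 * Derive q x * Derive (Derive (c (partner i))) x
         + q x * Derive (Derive (Derive (c (partner i)))) x
         + Derive (Derive r) x * c (partner i) x + 2 * Derive r x * Derive (c (partner i)) x
         + r x * Derive (Derive (c (partner i))) x).
Proof.
  intros HG Hi Hp Hq Hr HV.
  rewrite dt_dx by apply (smooth2_dx (coord_family G i)), HG.
  assert (S : forall i, smooth (c i)) by (intros; apply smooth_slice; apply HG).
  unfold dx at 1.
  rewrite (Derive_ext _ _ _ (fun y => dt_dx_coord L G t0 p q r i y HG Hi Hp Hq Hr HV)).
  apply is_derive_unique. now apply (is_derive_velocity_coord_deriv p q r (c i) (c (partner i))).
Qed.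

(** The x- and t-derivatives commute, so the variation of g_x is the x-derivative of
    the velocity; the terms in r and r_x drop out because i g_x and i g
    are real-orthogonal to g_x. *)
Lemma normsq_variation L G t0 p q r x : smooth_path L G ->
  smooth p -> smooth q -> smooth r ->
  (forall x, velocity G t0 x = frame_field (G t0) p q r x) ->
  dt (fun t x => normsq (G t) x) t0 x =
    2 * Derive p x * normsq (G t0) x + p x * Derive (normsq (G t0)) x - 2 * q x * twist (G t0) x.
Proof.
  intros HG Hp Hq Hr HV.
  assert (S : forall i, ex_derive (fun t => dx (coord_family G i) t x) t0).
  { intros i. apply (smooth2_ex_dt (dx (coord_family G i))). apply smooth2_dx, HG. }
  unfold dt. rewrite (Derive_ext _ _ _ (fun t => normsq_family G t x)).
  transitivity (2 * (dx (coord_family G 0) t0 x * dt (dx (coord_family G 0)) t0 x + dx (coord_family G 1) t0 x * dt (dx (coord_family G 1)) t0 x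
    + dx (coord_family G 2) t0 x * dt (dx (coord_family G 2)) t0 x + dx (coord_family G 3) t0 x * dt (dx (coord_family G 3)) t0 x));
    [exact (is_derive_unique _ _ _ (is_derive_sum_squares _ _ _ _ t0
    (S 0%nat) (S 1%nat) (S 2%nat) (S 3%nat)))|].
  rewrite !(dt_dx_coord L G t0 p q r _ x HG) by (auto; lia).
  destruct HG as [HG HP].
  rewrite (Derive_normsq (G t0) x) by apply HP.
  rewrite normsq_coord, twist_coord.
  destruct (legendrian_relations L (G t0) x (HP t0)) as (_ & _ & HI).
  unfold dx. fold (coord_family G 0 t0) (coord_family G 1 t0) (coord_family G 2 t0) (coord_family G 3 t0) in *.
  unfold partner, partner_sign.
  set (a0 := coord_family G 0 t0) in *. set (a1 := coord_family G 1 t0) in *.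
  set (a2 := coord_family G 2 t0) in *. set (a3 := coord_family G 3 t0) in *.
  change (Derive (fun z => coord_family G 0 t0 z)) with (Derive a0).
  change (Derive (fun z => coord_family G 1 t0 z)) with (Derive a1).
  change (Derive (fun z => coord_family G 2 t0 z)) with (Derive a2).
  change (Derive (fun z => coord_family G 3 t0 z)) with (Derive a3).
  change (fun y => coord (G t0 y) 0) with a0. change (fun y => coord (G t0 y) 1) with a1.
  change (fun y => coord (G t0 y) 2) with a2. change (fun y => coord (G t0 y) 3) with a3.
  apply Rminus_diag_uniq.
  match type of HI with ?I = 0 => transitivity (2 * Derive r x * I) end; [ | rewrite HI; ring].
  change (coord (G t0 x) 0) with (a0 x). change (coord (G t0 x) 1) with (a1 x).
  change (coord (G t0 x) 2) with (a2 x). change (coord (G t0 x) 3) with (a3 x).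
  ring.
Qed.

Lemma twist_variation L G t0 p q r x : smooth_path L G ->
  smooth p -> smooth q -> smooth r ->
  (forall x, velocity G t0 x = frame_field (G t0) p q r x) ->
  dt (fun t x => twist (G t) x) t0 x =
    p x * Derive (twist (G t0)) x + 3 * Derive p x * twist (G t0) x
    + q x * (Derive (Derive (normsq (G t0))) x / 2 - 2 * Re (herm (D (D (G t0)) x) (D (D (G t0)) x)))
    + Derive q x * Derive (normsq (G t0)) x / 2 + Derive (Derive q) x * normsq (G t0) x
    + 3 * Derive r x * normsq (G t0) x.
Proof.
  intros HG Hp Hq Hr HV.
  assert (S : forall i, ex_derive (fun t => dx (coord_family G i) t x) t0).
  { intros i. apply (smooth2_ex_dt (dx (coord_family G i))). apply smooth2_dx, HG. }
  assert (S2 : forall i, ex_derive (fun t => dx (dx (coord_family G i)) t x) t0).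
  { intros i. apply (smooth2_ex_dt (dx (dx (coord_family G i)))). apply smooth2_dx, smooth2_dx, HG. }
  unfold dt. rewrite (Derive_ext _ _ _ (fun t => twist_family G t x)).
  transitivity (
   (dt (dx (dx (coord_family G 1))) t0 x * dx (coord_family G 0) t0 x - dt (dx (dx (coord_family G 0))) t0 x * dx (coord_family G 1) t0 x
    + dt (dx (dx (coord_family G 3))) t0 x * dx (coord_family G 2) t0 x - dt (dx (dx (coord_family G 2))) t0 x * dx (coord_family G 3) t0 x)
  + (dx (dx (coord_family G 1)) t0 x * dt (dx (coord_family G 0)) t0 x - dx (dx (coord_family G 0)) t0 x * dt (dx (coord_family G 1)) t0 x
    + dx (dx (coord_family G 3)) t0 x * dt (dx (coord_family G 2)) t0 x - dx (dx (coord_family G 2)) t0 x * dt (dx (coord_family G 3)) t0 x));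
    [exact (is_derive_unique _ _ _ (is_derive_im_herm _ _ _ _ _ _ _ _ t0
    (S2 0%nat) (S2 1%nat) (S2 2%nat) (S2 3%nat) (S 0%nat) (S 1%nat) (S 2%nat) (S 3%nat)))|].
  rewrite !(dt_dx_coord L G t0 p q r _ x HG) by (auto; lia).
  rewrite !(dt_dx_dx_coord L G t0 p q r _ x HG) by (auto; lia).
  destruct HG as [HG HP].
  rewrite (Derive_normsq (G t0) x) by apply HP.
  rewrite (Derive2_normsq (G t0) x) by apply HP.
  rewrite (Derive_twist (G t0) x) by apply HP.
  rewrite twist_coord, Re_herm, !coord_DD.
  destruct (legendrian_relations L (G t0) x (HP t0)) as (_ & HR & _).
  destruct (legendrian_relations_deriv L (G t0) x (HP t0)) as (HR2 & _).
  rewrite normsq_coord in *.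
  unfold dx, partner, partner_sign.
  set (a0 := coord_family G 0 t0) in *. set (a1 := coord_family G 1 t0) in *.
  set (a2 := coord_family G 2 t0) in *. set (a3 := coord_family G 3 t0) in *.
  change (Derive (fun z => coord_family G 0 t0 z)) with (Derive a0).
  change (Derive (fun z => coord_family G 1 t0 z)) with (Derive a1).
  change (Derive (fun z => coord_family G 2 t0 z)) with (Derive a2).
  change (Derive (fun z => coord_family G 3 t0 z)) with (Derive a3).
  change (fun z => Derive a0 z) with (Derive a0). change (fun z => Derive a1 z) with (Derive a1).
  change (fun z => Derive a2 z) with (Derive a2). change (fun z => Derive a3 z) with (Derive a3).
  change (fun y => coord (G t0 y) 0) with a0 in *. change (fun y => coord (G t0 y) 1) with a1 in *.
  change (fun y => coord (G t0 y) 2) with a2 in *. change (fun y => coord (G t0 y) 3) with a3 in *.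
  change (coord (G t0 x) 0) with (a0 x) in *. change (coord (G t0 x) 1) with (a1 x) in *.
  change (coord (G t0 x) 2) with (a2 x) in *. change (coord (G t0 x) 3) with (a3 x) in *.
  apply Rminus_diag_uniq.
  (* The i g component enters through r_xx and r_x, with the products of g and g_x
     and of g and g_xx as coefficients. *)
  match type of HR with ?I = 0 => match type of HR2 with ?J = ?K =>
    transitivity (Derive (Derive r) x * I - Derive r x * (J - K)) end end; [ | rewrite HR, HR2; ring].
  field.
Qed.

(** |g_xx|^2 from the components of g_xx in the frame (g, g_x): that along g is
    -|g_x|^2, and the component along g_x has the derivative of the squared speed
    and [twist] as real and imaginary parts. *)
Lemma normsq_second_derivative L g x : PL L g ->
  normsq g x * Re (herm (D (D g) x) (D (D g) x)) =
    (Derive (normsq g) x / 2) ^ 2 + twist g x ^ 2 + normsq g x ^ 3.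
Proof.
  intros HP. rewrite (Derive_normsq g x) by apply HP.
  destruct (legendrian_relations L g x HP) as (H1 & H2 & H3). destruct (legendrian_relations_deriv L g x HP) as (H4 & H5).
  pose proof (gram_C2 _ _ _ _ _ _ _ _ 
    (Derive (Derive (fun y => coord (g y) 0)) x) (Derive (Derive (fun y => coord (g y) 1)) x)
    (Derive (Derive (fun y => coord (g y) 2)) x) (Derive (Derive (fun y => coord (g y) 3)) x) H1 H2 H3) as E.
  rewrite H4, H5 in E. rewrite <- (normsq_coord g x) in E.
  rewrite Re_herm, !coord_DD, twist_coord.
  match type of E with ?A = _ => transitivity A; [ring|] end. rewrite E. field.
Qed.

Lemma Derive_normsq_speed L g x : PL L g ->
  Derive (normsq g) x = 2 * speed g x * Derive (speed g) x.
Proof.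
  intros HP.
  rewrite (Derive_ext _ (fun y => speed g y * speed g y)) by (intros; symmetry; now apply (speed_sqr L)).
  pose proof (smooth_ex_derive _ x (smooth_speed L g HP)).
  rewrite Derive_mult by auto. ring.
Qed.

Lemma Derive2_normsq_speed L g x : PL L g ->
  Derive (Derive (normsq g)) x = 2 * Derive (speed g) x ^ 2 + 2 * speed g x * Derive (Derive (speed g)) x.
Proof.
  intros HP.
  rewrite (Derive_ext _ _ _ (fun y => Derive_normsq_speed L g y HP)).
  pose proof (smooth_speed L g HP) as S.
  pose proof (smooth_ex_derive _ x S) as S0.
  pose proof (smooth_ex_derive _ x (smooth_Derive _ S)) as S1.
  rewrite (Derive_mult (fun y => 2 * speed g y) (Derive (speed g)));
    [| now apply ex_derive_scal | auto].
  rewrite Derive_scal. change (Derive (fun x => speed g x)) with (Derive (speed g)). ring.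
Qed.

Lemma twist_curvature L g x : PL L g -> twist g x = curvature g x * speed g x ^ 3.
Proof.
  intros HP. pose proof (speed_pos L g x HP). unfold curvature, twist. field. lra.
Qed.

Lemma smooth_curvature L g : PL L g -> smooth (curvature g).
Proof. apply (smooth_jet L g 0). Qed.

Lemma Derive_twist_curvature L g x : PL L g -> Derive (twist g) x =
  Derive (curvature g) x * speed g x ^ 3 + 3 * curvature g x * speed g x ^ 2 * Derive (speed g) x.
Proof.
  intros HP.
  rewrite (Derive_ext _ _ _ (fun y => twist_curvature L g y HP)).
  pose proof (smooth_ex_derive _ x (smooth_speed L g HP)).
  pose proof (smooth_ex_derive _ x (smooth_curvature L g HP)).
  rewrite Derive_mult; [| auto | now apply ex_derive_pow].
  rewrite Derive_pow by auto. simpl. 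
  change (Derive (fun x => speed g x)) with (Derive (speed g)). 
  change (Derive (fun x => curvature g x)) with (Derive (curvature g)). ring.
Qed.

Lemma Ds_Ds_speed L g q x : PL L g -> smooth q ->
  Ds g (Ds g (fun y => q y * speed g y)) x =
  / speed g x * (Derive (Derive q) x + Derive q x * Derive (speed g) x / speed g x
     + q x * Derive (Derive (speed g)) x / speed g x
     - q x * Derive (speed g) x ^ 2 / speed g x ^ 2).
Proof.
  intros HP Hq. unfold Ds. f_equal.
  pose proof (smooth_speed L g HP) as S.
  rewrite (Derive_ext _ (fun y => Derive q y + q y * (Derive (speed g) y * / speed g y))).
  - pose proof (smooth_ex_derive _ x S) as S0.
    pose proof (smooth_ex_derive _ x (smooth_Derive _ S)) as S1.
    pose proof (smooth_ex_derive _ x Hq) as Q0.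
    pose proof (smooth_ex_derive _ x (smooth_Derive _ Hq)) as Q1.
    pose proof (speed_pos L g x HP) as Hv.
    remember (Derive (speed g)) as v' eqn:Ev. remember (Derive q) as q' eqn:Eq.
    remember (speed g) as v eqn:Ev0.
    apply is_derive_unique. auto_derive.
    + repeat split; auto. lra.
    + change (Derive (fun x => v' x)) with (Derive v'). change (Derive (fun x => q' x)) with (Derive q').
      change (Derive (fun x => v x)) with (Derive v). change (Derive (fun x => q x)) with (Derive q).
      rewrite <- Ev, <- Eq. field. lra.
  - intros y. rewrite Derive_mult; [| now apply smooth_ex_derive | now apply smooth_ex_derive].
    change (Derive (fun x => q x)) with (Derive q).
    pose proof (speed_pos L g y HP). field. lra.
Qed.

Lemma speed_variation L G t0 p q r x : smooth_path L G ->
  smooth p -> smooth q -> smooth r ->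
  (forall x, velocity G t0 x = frame_field (G t0) p q r x) ->
  dt (fun t x => speed (G t) x) t0 x =
    Derive p x * speed (G t0) x + p x * Derive (speed (G t0)) x
    - q x * curvature (G t0) x * speed (G t0) x ^ 2.
Proof.
  intros HG Hp Hq Hr HV.
  pose proof (normsq_variation L G t0 p q r x HG Hp Hq Hr HV) as E.
  pose proof (proj2 HG t0) as HP.
  rewrite (Derive_normsq_speed L _ x HP), (twist_curvature L _ x HP), <- (speed_sqr L _ x HP) in E.
  pose proof (speed_pos L _ x HP) as Hv.
  unfold dt in E at 1.
  rewrite (Derive_ext _ (fun t => speed (G t) x * speed (G t) x)) in E
    by (intros t; symmetry; apply (speed_sqr L); apply HG).
  pose proof (smooth2_ex_dt _ t0 x (smooth2_speed L G HG)) as S.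
  rewrite Derive_mult in E by exact S.
  fold (dt (fun t x => speed (G t) x) t0 x) in E.
  apply (Rmult_eq_reg_l (2 * speed (G t0) x)); [| lra].
  transitivity (dt (fun t x => speed (G t) x) t0 x * speed (G t0) x
    + speed (G t0) x * dt (fun t x => speed (G t) x) t0 x); [ring|].
  rewrite E. ring.
Qed.

(** With b = q v, the curvature varies by b_ss + (k^2 + 4) b, apart from the
    transport term of the tangential part p. The 4 combines the curvature of the
    sphere (through g_xx = ... - |g_x|^2 g) with the contribution of r_x = 2 q v^2. *)
Lemma curvature_variation L G t0 p q r x : smooth_path L G ->
  smooth p -> smooth q -> smooth r ->
  (forall x, Derive r x = 2 * q x * normsq (G t0) x) ->
  (forall x, velocity G t0 x = frame_field (G t0) p q r x) ->
  dt (fun t x => curvature (G t) x) t0 x =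
    p x * Derive (curvature (G t0)) x
    + Ds (G t0) (Ds (G t0) (fun y => q y * speed (G t0) y)) x
    + (curvature (G t0) x ^ 2 + 4) * (q x * speed (G t0) x).
Proof.
  intros HG Hp Hq Hr Hqr HV.
  pose proof (twist_variation L G t0 p q r x HG Hp Hq Hr HV) as E.
  pose proof (speed_variation L G t0 p q r x HG Hp Hq Hr HV) as Ev.
  pose proof (proj2 HG t0) as HP.
  pose proof (speed_pos L _ x HP) as Hv.
  pose proof (normsq_second_derivative L _ x HP) as Ha.
  rewrite (Ds_Ds_speed L) by auto.
  rewrite Hqr, (Derive2_normsq_speed L _ x HP), (Derive_twist_curvature L _ x HP) in E.
  rewrite (Derive_normsq_speed L _ x HP), (twist_curvature L _ x HP), <- (speed_sqr L _ x HP) in E.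
  rewrite (Derive_normsq_speed L _ x HP), (twist_curvature L _ x HP), <- (speed_sqr L _ x HP) in Ha.
  unfold dt in E at 1.
  rewrite (Derive_ext _ (fun t => curvature (G t) x * speed (G t) x ^ 3)) in E
    by (intros t; apply (twist_curvature L); apply HG).
  pose proof (smooth2_ex_dt _ t0 x (smooth2_speed L G HG)) as S.
  pose proof (smooth2_ex_dt _ t0 x (smooth2_curvature L G HG)) as S'.
  rewrite Derive_mult in E; [| exact S' | now apply ex_derive_pow].
  rewrite Derive_pow in E by exact S.
  fold (dt (fun t x => speed (G t) x) t0 x) in E.
  fold (dt (fun t x => curvature (G t) x) t0 x) in E.
  rewrite Ev in E.
  set (A := Re (herm (D (D (G t0)) x) (D (D (G t0)) x))) in *.
  set (Kt := dt (fun t x => curvature (G t) x) t0 x) in *.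
  set (v := speed (G t0) x) in *. set (k := curvature (G t0) x) in *.
  (* |g_xx|^2 in terms of speed and curvature, from the expansion in the frame. *)
  replace A with (((2 * v * Derive (speed (G t0)) x / 2) ^ 2 + (k * v ^ 3) ^ 2 + (v * v) ^ 3) / (v * v)) in E
    by (rewrite <- Ha; field; lra).
  apply (Rmult_eq_reg_r (v ^ 3)); [| now apply pow_nonzero, Rgt_not_eq].
  match type of E with _ + ?Y = ?Z => transitivity (Z - Y); [rewrite <- E; ring|] end.
  simpl (INR 3). simpl (pred 3). field. lra.
Qed.

(** * First variation of integrals of differential polynomials *)

Lemma smooth_opp f : smooth f -> smooth (fun x => - f x).
Proof. intros; apply (smooth_slice (fun _ x => - f x) 0). apply smooth2_opp; now apply smooth_lift. Qed.

Lemma smooth_minus f g : smooth f -> smooth g -> smooth (fun x => f x - g x).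
Proof. intros; apply smooth_plus; auto. now apply smooth_opp. Qed.

Ltac smooth_tac :=
  repeat first [ assumption | match goal with
  | |- smooth (fun x => _ * _) => apply smooth_mult
  | |- smooth (fun x => _ + _) => apply smooth_plus
  | |- smooth (fun x => - _) => apply smooth_opp
  | |- smooth (Derive _) => apply smooth_Derive
  | |- smooth (fun x => Derive _ x) => apply smooth_Derive
  end ]; auto using smooth_const.

Lemma RInt_plus_smooth f g a b : smooth f -> smooth g ->
  RInt (fun x => f x + g x) a b = RInt f a b + RInt g a b.
Proof. intros; now apply (RInt_plus (V := R_CompleteNormedModule)); apply smooth_ex_RInt. Qed.

Lemma RInt_scal_smooth c f a b : smooth f -> RInt (fun x => c * f x) a b = c * RInt f a b.
Proof. intros; now apply (RInt_scal (V := R_CompleteNormedModule)); apply smooth_ex_RInt. Qed.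

Lemma RInt_ext_all (f g : R -> R) a b : (forall x, f x = g x) -> RInt f a b = RInt g a b.
Proof. intros H; apply RInt_ext; auto. Qed.

Lemma is_derive_RInt_smooth2 F a b t : smooth2 F ->
  is_derive (fun t => RInt (F t) a b) t (RInt (dt F t) a b).
Proof.
  intros HF.
  apply (is_derive_RInt_param F a b t).
  - apply filter_forall. intros; now apply smooth2_ex_dt.
  - intros x _. apply (smooth2_continuity (dt F)). now apply smooth2_dt.
  - apply filter_forall. intros s. apply (smooth_ex_RInt (F s)). now apply smooth_slice.
Qed.

Lemma periodic_dt L F t : (forall s, periodic L (F s)) -> periodic L (dt F t).
Proof. intros H x. apply Derive_ext. intros s; apply H. Qed.

(** The tangential part p of the velocity moves the arclength derivatives of the
    curvature along the curve; without this transport their variation depends on q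
    alone. *)
Definition jet_variation (G : R -> curve) (t0 : R) (p : R -> R) (i : nat) (x : R) : R :=
  dt (fun t x => jet (G t) x i) t0 x - p x * Derive (fun y => jet (G t0) y i) x.

Lemma smooth_jet_variation L G t0 p i : smooth_path L G -> smooth p -> smooth (jet_variation G t0 p i).
Proof.
  intros HG Hp. apply smooth_minus.
  - apply (smooth_slice (dt (fun t x => jet (G t) x i))). now apply smooth2_dt, (smooth2_jet L).
  - apply smooth_mult; auto. apply smooth_Derive, (smooth_jet L). apply HG.
Qed.

Lemma periodic_jet_variation L G t0 p i : smooth_path L G -> periodic L p -> periodic L (jet_variation G t0 p i).
Proof.
  intros HG Hp x. unfold jet_variation.
  rewrite Hp, (periodic_dt L _ t0 (fun s => periodic_jet L (G s) i (proj2 HG s))).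
  now rewrite (periodic_Derive L _ (periodic_jet L (G t0) i (proj2 HG t0))).
Qed.

(** The variation changes arclength at the rate -k b, b = q v, so it fails to commute
    with d/ds by the term k b d/ds. *)
Lemma jet_variation_S L G t0 p q r i x : smooth_path L G ->
  smooth p -> smooth q -> smooth r ->
  (forall x, velocity G t0 x = frame_field (G t0) p q r x) ->
  jet_variation G t0 p (S i) x * speed (G t0) x = Derive (jet_variation G t0 p i) x
    + q x * curvature (G t0) x * speed (G t0) x ^ 2 * jet (G t0) x (S i).
Proof.
  intros HG Hp Hq Hr HV.
  pose proof (proj2 HG t0) as HP.
  pose proof (speed_pos L _ x HP) as Hv.
  pose proof (speed_variation L G t0 p q r x HG Hp Hq Hr HV) as Ev.
  pose proof (smooth2_jet L G i HG) as SJ.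
  set (F := fun t x => jet (G t) x i) in *.
  assert (E1 : dt (fun t x => jet (G t) x (S i)) t0 x =
    - dt (fun t x => speed (G t) x) t0 x / speed (G t0) x ^ 2 * Derive (F t0) x
    + / speed (G t0) x * Derive (dt F t0) x).
  { change (Derive (dt F t0) x) with (dx (dt F) t0 x). rewrite <- dt_dx by exact SJ.
    unfold dt at 1.
    rewrite (Derive_ext _ (fun t => / speed (G t) x * dx F t x)) by (intros; apply jet_S).
    pose proof (smooth2_ex_dt _ t0 x (smooth2_speed L G HG)) as S.
    rewrite Derive_mult; [| apply ex_derive_inv; [exact S | lra] | apply (smooth2_ex_dt (dx F)); now apply smooth2_dx].
    rewrite Derive_inv by (exact S || lra). reflexivity. }
  assert (E2 : Derive (fun y => jet (G t0) y (S i)) x =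
    - Derive (speed (G t0)) x / speed (G t0) x ^ 2 * Derive (F t0) x
    + / speed (G t0) x * Derive (Derive (F t0)) x).
  { rewrite (Derive_ext _ (fun y => / speed (G t0) y * Derive (F t0) y)) by (intros; apply jet_S).
    pose proof (smooth_ex_derive _ x (smooth_speed L _ HP)) as S.
    rewrite Derive_mult; [| apply ex_derive_inv; [exact S | lra] |
      apply smooth_ex_derive, smooth_Derive; now apply smooth_slice].
    rewrite Derive_inv by (exact S || lra). reflexivity. }
  assert (E3 : Derive (jet_variation G t0 p i) x =
    Derive (dt F t0) x - (Derive p x * Derive (F t0) x + p x * Derive (Derive (F t0)) x)).
  { unfold jet_variation.
    rewrite Derive_minus.
    - rewrite Derive_mult; [reflexivity | now apply smooth_ex_derive |].
      apply smooth_ex_derive, smooth_Derive. now apply (smooth_slice F).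
    - apply smooth_ex_derive, (smooth_slice (dt F)). now apply smooth2_dt.
    - apply smooth_ex_derive, smooth_mult; auto. apply smooth_Derive. now apply (smooth_slice F). }
  unfold jet_variation at 1. rewrite E1, E2, E3, Ev, jet_S. fold F.
  change (Derive (fun y => jet (G t0) y i) x) with (Derive (F t0) x).
  field. lra.
Qed.

Lemma jet_variation_0 L G t0 p q r x : smooth_path L G ->
  smooth p -> smooth q -> smooth r ->
  (forall x, Derive r x = 2 * q x * normsq (G t0) x) ->
  (forall x, velocity G t0 x = frame_field (G t0) p q r x) ->
  jet_variation G t0 p 0 x * speed (G t0) x =
    Derive (Ds (G t0) (fun y => q y * speed (G t0) y)) x
    + (curvature (G t0) x ^ 2 + 4) * (q x * normsq (G t0) x).
Proof.
  intros HG Hp Hq Hr Hqr HV.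
  pose proof (proj2 HG t0) as HP.
  pose proof (speed_pos L _ x HP) as Hv.
  unfold jet_variation. rewrite <- (speed_sqr L _ x HP).
  change (fun (t x0 : R) => jet (G t) x0 0) with (fun t x => curvature (G t) x).
  change (fun y : R => jet (G t0) y 0) with (curvature (G t0)).
  rewrite (curvature_variation L G t0 p q r x) by auto.
  unfold Ds at 1. field. lra.
Qed.

(** Iterating [jet_variation_S] and integrating by parts each time: the commutator
    terms picked up on the way add up to k b times [boundary i F]. *)
Lemma RInt_jet_variation L G t0 p q r i F : smooth_path L G ->
  smooth p -> smooth q -> smooth r -> periodic L p -> periodic L q ->
  (forall x, velocity G t0 x = frame_field (G t0) p q r x) ->
  RInt (fun x => dp_eval F (jet (G t0) x) * (jet_variation G t0 p i x * speed (G t0) x)) 0 L =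
  RInt (fun x => dp_eval (Nat.iter i neg_delta F) (jet (G t0) x)
                   * (jet_variation G t0 p 0 x * speed (G t0) x)
    + q x * curvature (G t0) x * normsq (G t0) x * dp_eval (boundary i F) (jet (G t0) x)) 0 L.
Proof.
  intros HG Hp Hq Hr Pp Pq HV.
  pose proof (proj2 HG t0) as HP.
  pose proof (smooth_speed L _ HP) as Sv. pose proof (smooth_normsq L _ HP) as Sm.
  pose proof (smooth_curvature L _ HP) as Sk.
  pose proof (fun i => smooth_jet_variation L G t0 p i HG Hp) as Sw.
  pose proof (fun P => smooth_dp_eval L _ P HP) as SP.
  revert F; induction i as [|i IH]; intros F.
  - apply RInt_ext_all. intros x. simpl. ring.
  - rewrite (RInt_ext_all _ (fun x => dp_eval F (jet (G t0) x) * Derive (jet_variation G t0 p i) x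
      + q x * curvature (G t0) x * normsq (G t0) x * dp_eval (F * dU (S i)) (jet (G t0) x))).
    2:{ intros x. rewrite (jet_variation_S L G t0 p q r i x) by auto. simpl.
        rewrite <- (speed_sqr L _ x HP). simpl. ring. }
    rewrite RInt_plus_smooth.
    2:{ smooth_tac. }
    2:{ smooth_tac. }
    rewrite (RInt_by_parts_periodic L (fun x => dp_eval F (jet (G t0) x)) (jet_variation G t0 p i));
      auto; [| now apply periodic_dp_eval | now apply periodic_jet_variation].
    rewrite (RInt_ext_all _ (fun x => dp_eval (neg_delta F) (jet (G t0) x)
       * (jet_variation G t0 p i x * speed (G t0) x))).
    2:{ intros x. rewrite (Derive_dp_eval L) by auto. simpl. ring. }
    rewrite IH, <- RInt_plus_smooth.
    + apply RInt_ext_all. intros x. rewrite Nat.iter_succ_r. simpl. ring.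
    + smooth_tac.
    + smooth_tac.
Qed.

Lemma RInt_sum_jet_variation L G t0 p q r n (F : nat -> dpoly) : smooth_path L G ->
  smooth p -> smooth q -> smooth r -> periodic L p -> periodic L q ->
  (forall x, velocity G t0 x = frame_field (G t0) p q r x) ->
  RInt (fun x => rsum n (fun i => dp_eval (F i) (jet (G t0) x) * jet_variation G t0 p i x)
                   * speed (G t0) x) 0 L =
  RInt (fun x => dp_eval (dp_sum n (fun i => Nat.iter i neg_delta (F i))) (jet (G t0) x)
                   * (jet_variation G t0 p 0 x * speed (G t0) x)
    + q x * curvature (G t0) x * normsq (G t0) x
        * dp_eval (dp_sum n (fun i => boundary i (F i))) (jet (G t0) x)) 0 L.
Proof.
  intros HG Hp Hq Hr Pp Pq HV.
  pose proof (proj2 HG t0) as HP.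
  pose proof (smooth_speed L _ HP) as Sv. pose proof (smooth_normsq L _ HP) as Sm.
  pose proof (smooth_curvature L _ HP) as Sk.
  pose proof (fun i => smooth_jet_variation L G t0 p i HG Hp) as Sw.
  pose proof (fun P => smooth_dp_eval L _ P HP) as SP.
  assert (Ssum : forall n, smooth (fun x =>
     rsum n (fun i => dp_eval (F i) (jet (G t0) x) * jet_variation G t0 p i x))).
  { intros m; induction m as [|m IH]; [exact (smooth_const 0)|].
    apply (smooth_plus _ (fun x => dp_eval (F m) (jet (G t0) x) * jet_variation G t0 p m x)); auto.
    apply smooth_mult; auto. }
  induction n as [|n IH].
  - apply RInt_ext_all. intros x. simpl. ring.
  - rewrite (RInt_ext_all _ (fun x =>
      rsum n (fun i => dp_eval (F i) (jet (G t0) x) * jet_variation G t0 p i x) * speed (G t0) x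
      + dp_eval (F n) (jet (G t0) x) * (jet_variation G t0 p n x * speed (G t0) x)))
      by (intros; simpl; ring).
    rewrite RInt_plus_smooth; [| now apply smooth_mult | smooth_tac].
    rewrite IH, (RInt_jet_variation L G t0 p q r), <- RInt_plus_smooth by
      smooth_tac.
    apply RInt_ext_all. intros x. simpl. ring.
Qed.

(** Two more integrations by parts move the two arclength derivatives of b = q v in
    the variation of the curvature onto [E]. *)
Lemma RInt_jet_variation_0 L G t0 p q r E : smooth_path L G ->
  smooth p -> smooth q -> smooth r -> periodic L q ->
  (forall x, Derive r x = 2 * q x * normsq (G t0) x) ->
  (forall x, velocity G t0 x = frame_field (G t0) p q r x) ->
  RInt (fun x => dp_eval E (jet (G t0) x) * (jet_variation G t0 p 0 x * speed (G t0) x)) 0 L =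
  RInt (fun x => q x * normsq (G t0) x *
    dp_eval (delta (delta E) + (dU 0 * dU 0 + dC 4) * E) (jet (G t0) x)) 0 L.
Proof.
  intros HG Hp Hq Hr Pq Hqr HV.
  pose proof (proj2 HG t0) as HP.
  pose proof (smooth_speed L _ HP) as Sv. pose proof (smooth_normsq L _ HP) as Sm.
  pose proof (smooth_curvature L _ HP) as Sk. pose proof (smooth_inv_speed L _ HP) as Siv.
  pose proof (periodic_speed L _ HP) as Pv.
  pose proof (fun P => smooth_dp_eval L _ P HP) as SP.
  set (b := fun y => q y * speed (G t0) y).
  assert (Sb : smooth b) by now apply smooth_mult.
  assert (Pb : periodic L b) by (intros x; unfold b; now rewrite Pq, Pv).
  assert (Sbs : smooth (Ds (G t0) b)) by (unfold Ds; smooth_tac).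
  assert (Pbs : periodic L (Ds (G t0) b)).
  { intros x; unfold Ds. now rewrite Pv, (periodic_Derive L b Pb). }
  rewrite (RInt_ext_all _ (fun x => dp_eval E (jet (G t0) x) * Derive (Ds (G t0) b) x
     + q x * normsq (G t0) x * dp_eval ((dU 0 * dU 0 + dC 4) * E) (jet (G t0) x))).
  2:{ intros x. rewrite (jet_variation_0 L G t0 p q r x) by auto. fold b. simpl.
      change (jet (G t0) x 0) with (curvature (G t0) x). ring. }
  rewrite RInt_plus_smooth; [| smooth_tac
                             | smooth_tac].
  rewrite (RInt_by_parts_periodic L (fun x => dp_eval E (jet (G t0) x))); auto;
    [| now apply periodic_dp_eval].
  rewrite (RInt_ext_all _ (fun x => dp_eval (neg_delta E) (jet (G t0) x) * Derive b x)).
  2:{ intros x. rewrite (Derive_dp_eval L) by auto. unfold Ds. simpl.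
      pose proof (speed_pos L _ x HP). field. lra. }
  rewrite (RInt_by_parts_periodic L (fun x => dp_eval (neg_delta E) (jet (G t0) x))); auto;
    [| now apply periodic_dp_eval].
  rewrite <- RInt_plus_smooth; [| | smooth_tac].
  2:{ smooth_tac. }
  apply RInt_ext_all. intros x. rewrite (Derive_dp_eval L) by auto.
  unfold neg_delta. rewrite delta_mult, delta_C. unfold b. rewrite <- (speed_sqr L _ x HP). simpl. ring.
Qed.

Definition density_integral (L : R) (P : dpoly) (g : curve) : R :=
  RInt (fun x => dp_eval P (jet g x) * speed g x) 0 L.

(** The tangential part of the velocity contributes the total derivative of
    p P v. What is left is E(P) paired with the variation of the curvature, the
    commutator terms, and -k b P from the variation of arclength; the last two make
    up k b (N - k E(P)) with N = [noether P], and the k^2 terms cancel. *)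
Lemma first_variation L G t0 p q r P : smooth_path L G ->
  smooth p -> smooth q -> smooth r -> periodic L p -> periodic L q ->
  (forall x, Derive r x = 2 * q x * normsq (G t0) x) ->
  (forall x, velocity G t0 x = frame_field (G t0) p q r x) ->
  is_derive (fun t => density_integral L P (G t)) t0
   (RInt (fun x => q x * normsq (G t0) x *
      dp_eval (delta (delta (euler P)) + dC 4 * euler P + dU 0 * noether P) (jet (G t0) x)) 0 L).
Proof.
  intros HG Hp Hq Hr Pp Pq Hqr HV.
  pose proof (proj2 HG t0) as HP.
  pose proof (smooth_speed L _ HP) as Sv. pose proof (smooth_normsq L _ HP) as Sm.
  pose proof (smooth_curvature L _ HP) as Sk.
  pose proof (periodic_speed L _ HP) as Pv.
  pose proof (fun P => smooth_dp_eval L _ P HP) as SP.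
  pose proof (fun i => smooth_jet_variation L G t0 p i HG Hp) as Sw.
  set (F := fun t x => dp_eval P (jet (G t) x) * speed (G t) x).
  assert (SF : smooth2 F).
  { apply smooth2_mult; [now apply (smooth2_dp_eval L) | now apply (smooth2_speed L)]. }
  pose proof (is_derive_RInt_smooth2 F 0 L t0 SF) as HD.
  match type of HD with is_derive _ _ ?A => match goal with |- is_derive _ _ ?B =>
    replace B with A; [exact HD|] end end.
  (* The flux of the density along the tangential part; only its derivative enters. *)
  set (T := fun x => p x * (dp_eval P (jet (G t0) x) * speed (G t0) x)).
  assert (ST : smooth T) by (unfold T; smooth_tac).
  rewrite (RInt_ext_all _ (fun x =>
      (rsum (dp_bound P) (fun i => dp_eval (dp_partial i P) (jet (G t0) x) * jet_variation G t0 p i x)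
                   * speed (G t0) x
       + q x * curvature (G t0) x * normsq (G t0) x * dp_eval (dC (-1) * P) (jet (G t0) x))
      + Derive T x)).
  2:{ intros x. 
      assert (D1 : dt F t0 x = dp_diff P (jet (G t0) x) (fun i => dt (fun t x => jet (G t) x i) t0 x)
                                * speed (G t0) x
            + dp_eval P (jet (G t0) x) * dt (fun t x => speed (G t) x) t0 x).
      { apply is_derive_unique.
        apply (is_derive_mult (fun t => dp_eval P (jet (G t) x)) (fun t => speed (G t) x)).
        - apply (is_derive_dp_eval P (fun t => jet (G t) x)). intros i _.
          apply Derive_correct. apply (smooth2_ex_dt (fun t x => jet (G t) x i)).
          now apply (smooth2_jet L).
        - apply Derive_correct. apply (smooth2_ex_dt (fun t x => speed (G t) x)).
          now apply (smooth2_speed L).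
        - intros; apply Rmult_comm. }
      assert (D2 : Derive T x = Derive p x * (dp_eval P (jet (G t0) x) * speed (G t0) x)
         + p x * (dp_diff P (jet (G t0) x) (fun i => Derive (fun y => jet (G t0) y i) x) * speed (G t0) x
             + dp_eval P (jet (G t0) x) * Derive (speed (G t0)) x)).
      { unfold T. rewrite Derive_mult by (apply smooth_ex_derive; auto; now apply smooth_mult).
        rewrite Derive_mult by (apply smooth_ex_derive; auto).
        do 4 f_equal. apply is_derive_unique. apply (is_derive_dp_eval P (jet (G t0))).
        intros i _. apply Derive_correct, smooth_ex_derive. now apply (smooth_jet L). }
      assert (D3 : dp_diff P (jet (G t0) x) (fun i => dt (fun t x => jet (G t) x i) t0 x)
        = rsum (dp_bound P) (fun i => dp_eval (dp_partial i P) (jet (G t0) x) * jet_variation G t0 p i x)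
          + p x * dp_diff P (jet (G t0) x) (fun i => Derive (fun y => jet (G t0) y i) x)).
      { unfold dp_diff. rewrite <- rsum_scal, <- rsum_plus. apply rsum_ext.
        intros i _. unfold jet_variation. ring. }
      rewrite D1, D2, D3, (speed_variation L G t0 p q r x), <- (speed_sqr L _ x HP) by auto.
      simpl. ring. }
  assert (Ssum : smooth (fun x => rsum (dp_bound P)
     (fun i => dp_eval (dp_partial i P) (jet (G t0) x) * jet_variation G t0 p i x) * speed (G t0) x)).
  { apply smooth_mult; auto. generalize (dp_bound P).
    intros m; induction m as [|m IH]; [exact (smooth_const 0)|].
    apply (smooth_plus _ (fun x => dp_eval (dp_partial m P) (jet (G t0) x) * jet_variation G t0 p m x)); auto.
    apply smooth_mult; auto. }
  rewrite RInt_plus_smooth; [| | now apply smooth_Derive].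
  2:{ smooth_tac. }
  rewrite RInt_Derive_periodic; [| auto |].
  2:{ intros x. unfold T. now rewrite Pp, Pv, (periodic_dp_eval L _ P HP). }
  rewrite RInt_plus_smooth; [| auto | smooth_tac].
  rewrite (RInt_sum_jet_variation L G t0 p q r) by auto.
  rewrite RInt_plus_smooth; [| smooth_tac ..].
  change (dp_sum (dp_bound P) (fun i => Nat.iter i neg_delta (dp_partial i P))) with (euler P).
  rewrite (RInt_jet_variation_0 L G t0 p q r) by auto.
  rewrite Rplus_0_r, <- !RInt_plus_smooth by smooth_tac.
  apply RInt_ext_all. intros x. unfold noether. simpl.
  change (jet (G t0) x 0) with (curvature (G t0) x). ring.
Qed.

(** * The Hamiltonians *)

(** The value at [n] is the Hamiltonian of the field with index n + 1. The first
    variation of the integral of rho_j pairs q v^2 with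
    E(rho_(j+1)) + 4 E(rho_j) - c u, where c is the constant term of rho_j. The
    correction by length removes -c u, since the variation of length is the pairing
    with -u; the previous Hamiltonian removes 4 E(rho_j). *)
Fixpoint hamiltonian (L : R) (rho : nat -> dpoly) (n : nat) (g : curve) : R :=
  match n with
  | 0%nat => 4 * density_integral L (dC 1) g
  | S m => -4 * (density_integral L (rho n) g
                 - constant_term (rho n) * density_integral L (dC 1) g)
           - 4 * hamiltonian L rho m g
  end.

Lemma hamiltonian_variation L G t0 p q r rho M N Lam n :
  mKdV_hierarchy rho M N Lam -> smooth_path L G ->
  smooth p -> smooth q -> smooth r -> periodic L p -> periodic L q ->
  (forall x, Derive r x = 2 * q x * normsq (G t0) x) ->
  (forall x, velocity G t0 x = frame_field (G t0) p q r x) ->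
  is_derive (fun t => hamiltonian L rho n (G t)) t0
   (RInt (fun x => q x * normsq (G t0) x * (-4 * dp_eval (euler (rho (S n))) (jet (G t0) x))) 0 L).
Proof.
  intros HH HG Hp Hq Hr Pp Pq Hqr HV.
  pose proof (proj2 HG t0) as HP. pose proof (smooth_normsq L _ HP) as Sm.
  pose proof (fun P => smooth_dp_eval L _ P HP) as SP.
  set (pairing := fun P => RInt (fun x => q x * normsq (G t0) x * dp_eval P (jet (G t0) x)) 0 L).
  assert (FV : forall P, is_derive (fun t => density_integral L P (G t)) t0
     (pairing (delta (delta (euler P)) + dC 4 * euler P + dU 0 * noether P)%dp)).
  { intros P. now apply (first_variation L G t0 p q r). }
  assert (Eq : forall P Q, (P == Q)%dp -> pairing P = pairing Q).
  { intros P Q H. apply RInt_ext_all. intros x. now rewrite H. }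
  assert (Lin : forall a b P Q, pairing (dC a * P + dC b * Q)%dp = a * pairing P + b * pairing Q).
  { intros a b P Q. unfold pairing.
    rewrite <- !RInt_scal_smooth, <- RInt_plus_smooth by smooth_tac.
    apply RInt_ext_all. intros x. cbn [dp_eval]. ring. }
  assert (Hlen : is_derive (fun t => density_integral L (dC 1) (G t)) t0 (pairing (dC (-1) * dU 0)%dp)).
  { rewrite (Eq (dC (-1) * dU 0)%dp (delta (delta (euler (dC 1))) + dC 4 * euler (dC 1)
       + dU 0 * noether (dC 1))%dp); [apply FV|].
    intros a. unfold noether, euler, delta. simpl. ring. }
  change (RInt (fun x => q x * normsq (G t0) x * (-4 * dp_eval (euler (rho (S n))) (jet (G t0) x))) 0 L)
    with (pairing (dC (-4) * euler (rho (S n)))%dp).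
  induction n as [|n IH].
  - rewrite (Eq _ (dC 4 * (dC (-1) * dU 0) + dC 0 * dU 0)%dp).
    + rewrite Lin, Rmult_0_l, Rplus_0_r. now apply (is_derive_scal _ _ 4).
    + intros a. simpl. rewrite (euler_rho_1 _ _ _ _ HH a). simpl. ring.
  - simpl hamiltonian. set (c := constant_term (rho (S n))).
    pose proof (FV (rho (S n))) as HR.
    set (A := (delta (delta (euler (rho (S n)))) + dC 4 * euler (rho (S n))
               + dU 0 * noether (rho (S n)))%dp) in *.
    replace (pairing (dC (-4) * euler (rho (S (S n))))%dp)
      with (-4 * (pairing A - c * pairing (dC (-1) * dU 0)%dp)
            - 4 * pairing (dC (-4) * euler (rho (S n)))%dp).
    + pose proof (is_derive_scal _ _ (-4) _ (is_derive_minus _ _ _ _ _ HR (is_derive_scal _ _ c _ Hlen))) as H1.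
      exact (is_derive_minus _ _ _ _ _ H1 (is_derive_scal _ _ 4 _ IH)).
    + rewrite (Eq (dC (-4) * euler (rho (S (S n))))%dp
        (dC (-4) * (dC 1 * A + dC (- c) * (dC (-1) * dU 0)) + dC (-4) * (dC (-4) * euler (rho (S n))))%dp).
      * rewrite !Lin. ring.
      * intros a. cbn [dp_eval]. rewrite (euler_hierarchy _ _ _ _ (S n) HH) by lia. unfold A. cbn [dp_eval].
        rewrite (noether_hierarchy _ _ _ _ (S n) HH) by lia. cbn [dp_eval]. fold c. ring.
Qed.

Lemma coord_inj z w : (forall i, coord z i = coord w i) -> z = w.
Proof.
  intros H. destruct z as [[a b] [c d]], w as [[a' b'] [c' d']].
  pose proof (H 0%nat) as H0. pose proof (H 1%nat) as H1.
  pose proof (H 2%nat) as H2. pose proof (H 3%nat) as H3. simpl in *. congruence.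
Qed.

(** The velocity of each generating flow has q = 0, and the first variation only sees
    q; hence the Hamiltonians are constant along the flows. *)
Lemma hamiltonian_on_QL L rho M N Lam n :
  mKdV_hierarchy rho M N Lam -> functional_on_QL L (hamiltonian L rho n).
Proof.
  intros HH g h _ _ Hgh.
  (* It suffices to treat one flow, along which the time derivative vanishes. *)
  induction Hgh as [g h (X & G & t & HX & [HG HV] & <- & <-) | g | g h _ IH | g h k _ IH1 _ IH2];
    [| reflexivity | now symmetry | now transitivity (hamiltonian L rho n h)].
  apply (is_derive_0_const (fun t => hamiltonian L rho n (G t))). intros t0.
  assert (E : exists p r, smooth p /\ smooth r /\ periodic L p /\ (forall x, Derive r x = 0) /\
    forall x, velocity G t0 x = frame_field (G t0) p (fun _ => 0) r x).
  { destruct HX as [-> | (f & Sf & Pf & ->)].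
    - exists (fun _ => 0), (fun _ => 1).
      refine (conj (smooth_const 0) (conj (smooth_const 1) (conj _ (conj _ _)))).
      + now intros x.
      + intros x. apply Derive_const.
      + intros x. rewrite HV. apply coord_inj. intros i. rewrite coord_frame_field.
        destruct (G t0 x) as [[a b] [c d]]. destruct i as [|[|[|i]]]; simpl; ring.
    - exists f, (fun _ => 0).
      refine (conj Sf (conj (smooth_const 0) (conj Pf (conj _ _)))).
      + intros x. apply Derive_const.
      + intros x. rewrite HV. apply coord_inj. intros i. rewrite coord_frame_field.
        generalize (D (G t0) x). intros [[a b] [c d]]. destruct i as [|[|[|i]]]; simpl; ring. }
  destruct E as (p & r & Sp & Sr & Pp & Hr & HVr).
  assert (Hr' : forall x, Derive r x = 2 * 0 * normsq (G t0) x) by (intros x; rewrite Hr; ring).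
  assert (P0 : periodic L (fun _ => 0)) by easy.
  pose proof (hamiltonian_variation L G t0 p (fun _ => 0) r rho M N Lam n HH HG Sp
    (smooth_const 0) Sr Pp P0 Hr' HVr) as HD.
  rewrite (RInt_ext_all _ (fun _ => 0)), RInt_const in HD by (intros; ring).
  replace 0 with (scal (L - 0) 0) by apply Rmult_0_r. exact HD.
Qed.

Lemma detR_complex_span (z w : C2) (p q r p' q' r' : R) :
  detR z w (p *r: w + q *r: (Ci *: w) + r *r: (Ci *: z))%C2
    (p' *r: w + q' *r: (Ci *: w) + r' *r: (Ci *: z))%C2 =
  (q * r' - r * q') * (Re (herm z z) * Re (herm w w) - (Re (herm w z) ^ 2 + Im (herm w z) ^ 2)).
Proof.
  destruct z as [[a b] [c d]], w as [[a' b'] [c' d']].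
  unfold detR, det; simpl. ring.
Qed.

Lemma detR_frame L g p q r p' q' r' x : PL L g ->
  detR (g x) (D g x) (frame_field g p q r x) (frame_field g p' q' r' x) =
    (q x * r' x - r x * q' x) * normsq g x.
Proof.
  intros (_ & H1 & _ & H2 & _).
  unfold frame_field. rewrite detR_complex_span, H1, H2. unfold normsq. simpl. ring.
Qed.

Lemma frame_field_add g p q r c f x :
  (frame_field g p q r x + c *r: (Ci *: g x) + f x *r: D g x)%C2 =
  frame_field g (fun x => p x + f x) q (fun x => r x + c) x.
Proof.
  unfold frame_field. generalize (D g x) (g x). intros [[a b] [c' d]] [[a1 b1] [c1 d1]].
  apply coord_inj. intros [|[|[|i]]]; simpl; ring.
Qed.

Lemma mKdV_field_frame N M Lam g x :
  mKdV_field N M Lam g x =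
  frame_field g (fun x => dp_eval N (jet g x) * / speed g x)
    (fun x => dp_eval M (jet g x) * / speed g x) (fun x => dp_eval Lam (jet g x)) x.
Proof.
  unfold mKdV_field, unit_tangent, frame_field.
  generalize (D g x) (g x). intros [[a b] [c' d]] [[a1 b1] [c1 d1]].
  apply coord_inj. intros [|[|[|i]]]; simpl; ring.
Qed.

Lemma Derive_euler_rho L rho M N Lam j g x :
  mKdV_hierarchy rho M N Lam -> (1 <= j)%nat -> PL L g ->
  Derive (fun y => dp_eval (euler (rho j)) (jet g y)) x = dp_eval (M j) (jet g x) * speed g x.
Proof.
  intros [_ H] Hj HP. destruct (H j Hj) as (HM & _).
  rewrite (Derive_dp_eval L) by auto. rewrite HM. ring.
Qed.

Lemma Lam_euler_rho rho M N Lam j a :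
  mKdV_hierarchy rho M N Lam -> (1 <= j)%nat ->
  dp_eval (Lam j) a = 2 * dp_eval (euler (rho j)) a.
Proof. intros [_ H] Hj. destruct (H j Hj) as (_ & HL & _). now rewrite HL. Qed.

Lemma mKdV_field_TPL L rho M N Lam j g :
  mKdV_hierarchy rho M N Lam -> (1 <= j)%nat -> PL L g ->
  TPL L g (mKdV_field (N j) (M j) (Lam j) g).
Proof.
  intros HH Hj HP.
  pose proof (smooth_inv_speed L g HP) as Siv. pose proof (periodic_speed L g HP) as Pv.
  pose proof (fun P => smooth_dp_eval L g P HP) as SP.
  pose proof (fun P => periodic_dp_eval L g P HP) as PP.
  exists (fun x => dp_eval (N j) (jet g x) * / speed g x),
    (fun x => dp_eval (M j) (jet g x) * / speed g x), (fun x => dp_eval (Lam j) (jet g x)).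
  refine (conj (conj _ (conj _ _)) (conj (conj _ (conj _ _)) (conj _ _))).
  - smooth_tac.
  - smooth_tac.
  - apply SP.
  - intros x. now rewrite Pv, (PP (N j)).
  - intros x. now rewrite Pv, (PP (M j)).
  - apply PP.
  - intros x.
    rewrite (Derive_ext _ (fun y => 2 * dp_eval (euler (rho j)) (jet g y)))
      by (intros; now apply (Lam_euler_rho rho M N Lam)).
    rewrite Derive_scal, (Derive_euler_rho L rho M N Lam) by auto.
    rewrite <- (speed_sqr L g x HP). pose proof (speed_pos L g x HP). field. lra.
  - intros x. apply mKdV_field_frame.
Qed.

(** The determinant is (q L_j - r M_j / v) v^2. Since v M_j is the x-derivative of
    E(rho_j) and r_x = 2 q v^2, integrating by parts makes the second term equal to
    the first. The ambiguity [c], [f] of the representative only adds an integral of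
    r_x, which vanishes. *)
Lemma Omega_mKdV_field L rho M N Lam j g p q r c f :
  mKdV_hierarchy rho M N Lam -> (1 <= j)%nat -> PL L g ->
  smooth q -> smooth r -> periodic L q -> periodic L r ->
  (forall x, Derive r x = 2 * q x * normsq g x) ->
  Omega L g (frame_field g p q r)
    (fun x => (mKdV_field (N j) (M j) (Lam j) g x + c *r: (Ci *: g x) + f x *r: D g x)%C2) =
  RInt (fun x => q x * normsq g x * (-4 * dp_eval (euler (rho j)) (jet g x))) 0 L.
Proof.
  intros HH Hj HP Sq Sr Pq Pr Hr.
  pose proof (fun P => smooth_dp_eval L g P HP) as SP.
  pose proof (smooth_normsq L g HP) as Sm.
  pose proof (fun P => periodic_dp_eval L g P HP) as PP.
  set (E := fun x => dp_eval (euler (rho j)) (jet g x)).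
  assert (SE : smooth E) by apply SP.
  assert (PE : periodic L E) by apply PP.
  unfold Omega.
  (* v M_j is the derivative of E, and q v^2 = r_x / 2 in the term with c. *)
  rewrite (RInt_ext_all _ (fun x => (2 * (q x * normsq g x * E x) + c / 2 * Derive r x)
     + -1 * (r x * Derive E x))).
  2:{ intros x. rewrite mKdV_field_frame, frame_field_add, (detR_frame L) by auto.
      unfold E at 2. rewrite (Derive_euler_rho L rho M N Lam), (Lam_euler_rho rho M N Lam) by auto.
      rewrite Hr, <- (speed_sqr L g x HP). pose proof (speed_pos L g x HP). unfold E. field. lra. }
  assert (S2 : smooth (fun x => -1 * (r x * Derive E x))) by smooth_tac.
  rewrite RInt_plus_smooth, RInt_plus_smooth, !RInt_scal_smooth by smooth_tac.
  rewrite RInt_Derive_periodic, (RInt_by_parts_periodic L r E) by auto.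
  rewrite (RInt_ext_all (fun x => - Derive r x * E x) (fun x => -2 * (q x * normsq g x * E x)))
    by (intros; rewrite Hr; ring).
  rewrite (RInt_ext_all (fun x => q x * normsq g x * (-4 * dp_eval (euler (rho j)) (jet g x)))
    (fun x => -4 * (q x * normsq g x * E x))) by (intros; unfold E; ring).
  rewrite !RInt_scal_smooth by smooth_tac. ring.
Qed.

Theorem proposition3p8 (L : R) (rho M N Lam : nat -> dpoly)
    (hL : 0 < L) (hierarchy : mKdV_hierarchy rho M N Lam)
    (j : nat) (hj : (1 <= j)%nat) :
  represents_hamiltonian_field L (mKdV_field (N j) (M j) (Lam j)).
Proof.
  split; [intros g HP; now apply (mKdV_field_TPL L rho)|].
  exists (hamiltonian L rho (pred j)).
  split; [now apply (hamiltonian_on_QL L rho M N Lam)|].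
  intros g V V' W HP (p & q & r & (Sp & Sq & Sr) & (Pp & Pq & Pr) & Hqr & HV) _ _
    (c & f & Sf & Pf & HV') (c' & f' & Sf' & Pf' & HW) G HG <- HGV.
  assert (EV : V' = frame_field (G 0) (fun x => p x + f x) q (fun x => r x + c)).
  { apply functional_extensionality; intros x.
    rewrite HV', HV. exact (frame_field_add (G 0) p q r c f x). }
  assert (EW : W = fun x => (mKdV_field (N j) (M j) (Lam j) (G 0) x
      + c' *r: (Ci *: G 0 x) + f' x *r: D (G 0) x)%C2)
    by (apply functional_extensionality; exact HW).
  rewrite EV, EW, (Omega_mKdV_field L rho); auto.
  - replace (rho j) with (rho (S (pred j))) by (f_equal; lia).
    apply (hamiltonian_variation L G 0 p q r rho M N Lam); auto.
    intros x. now rewrite HGV, HV.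
  - apply smooth_plus; auto. exact (smooth_const c).
  - intros x. now rewrite Pr.
  - intros x. rewrite Derive_plus, Derive_const, Hqr; [ring | | apply ex_derive_const].
    now apply smooth_ex_derive.
Qed.
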